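(* Let $N=(N^{2n+1},\phi,\xi,\eta,g)$ be a Sasakian manifold endowed with the Tanaka-Webster connection $\widehat{\nabla}$, and let $\alpha:I\rightarrow N$ be a pseudo-Hermitian $\phi$-helix of order $r\leq 3$, with $E_1=\alpha'$ and $\cos\theta=\eta(E_1)$. Then: (a) If $\cos\theta=\pm1$, then $\alpha$ is an integral curve of $\pm\xi$, i.e. a pseudo-Hermitian geodesic, and it is a pseudo-Hermitian magnetic curve for $F_q$ for arbitrary $q$. (b) If $\cos\theta\notin\{-1,0,1\}$ and $\widehat{k}_1=0$, then $\alpha$ is a pseudo-Hermitian non-Legendre slant geodesic and it is a pseudo-Hermitian magnetic curve for $F_{2\cos\theta}$. (c) If $\cos\theta=0$ and $\widehat{k}_1\neq0$, i.e. $\alpha$ is a Legendre $\phi$-curve, then it is a pseudo-Hermitian circle which is a pseudo-Hermitian magnetic curve for $F_{-\delta\widehat{k}_1}$, where $\delta=\mathrm{sgn}(g(\phi E_1,E_2))$. (d) If $\cos\theta=\dfrac{\varepsilon\widehat{k}_2}{\sqrt{\widehat{k}_1^2+\widehat{k}_2^2}}$ and $\widehat{k}_2\neq0$, then $\alpha$ is a pseudo-Hermitian magnetic curve for $F_q$ with $$q=-\delta\sqrt{\widehat{k}_1^2+\widehat{k}_2^2}+\frac{2\varepsilon\widehat{k}_2}{\sqrt{\widehat{k}_1^2+\widehat{k}_2^2}},$$ where $\delta=\mathrm{sgn}(g(\phi E_1,E_2))$ and $\varepsilon=\mathrm{sgn}(\cos\theta)$. (e) If none of the following four conditions holds identically along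 $\alpha$: [$\cos\theta=\pm1$]; [$\cos\theta\notin\{-1,0,1\}$ and $\widehat{k}_1=0$]; [$\cos\theta=0$ and $\widehat{k}_1\neq0$]; [$\cos\theta=\dfrac{\varepsilon\widehat{k}_2}{\sqrt{\widehat{k}_1^2+\widehat{k}_2^2}}$ and $\widehat{k}_2\neq0$, where $\varepsilon=\mathrm{sgn}(\cos\theta)$], then $\alpha$ cannot be a pseudo-Hermitian magnetic curve for any $F_q$ with $q\neq0$.
   Context: An almost contact metric manifold $(N^{2n+1},\phi,\xi,\eta,g)$ is a $(2n+1)$-dimensional manifold with a $(1,1)$-tensor field $\phi$, a vector field $\xi$, a 1-form $\eta$ and a Riemannian metric $g$ such that $\phi^2X=-X+\eta(X)\xi$, $\eta(\xi)=1$, $\phi\xi=0$, $\eta\circ\phi=0$, $g(X,\xi)=\eta(X)$, $g(X,Y)=g(\phi X,\phi Y)+\eta(X)\eta(Y)$. It is a contact metric manifold if $d\eta(X,Y)=g(X,\phi Y)$, and Sasakian if it is contact metric and the Nijenhuis torsion satisfies $[\phi,\phi](X,Y)=-2d\eta(X,Y)\xi$; here $d\eta(X,Y)=\frac12(X\eta(Y)-Y\eta(X)-\eta([X,Y]))$. With $\nabla$ the Levi-Civita connection (so that $\nabla_X\xi=-\phi X$ in the Sasakian case), the Tanaka-Webster connection of a Sasakian manifold is $$\widehat{\nabla}_XY=\nabla_XY+\eta(X)\phi Y+\eta(Y)\phi X-g(\phi X,Y)\xi.$$ Pseudo-Hermitian magnetic curve: a unit-speed curve $\alpha$ with $E_1=\alpha'$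 is pseudo-Hermitian magnetic for the contact magnetic field $F_q(X,Y)=q\,g(X,\phi Y)$ of strength $q\in\mathbb{R}$ if $\widehat{\nabla}_{E_1}E_1=[-q+2\eta(E_1)]\phi E_1$. A unit-speed curve $\alpha$ is slant if $\eta(E_1)=\cos\theta$ is constant ($\theta\in[0,\pi]$ is the contact angle). It is Legendre if $\eta(E_1)=0$. Conditions on $\cos\theta$ in the statement are understood to hold identically along $\alpha$. Frenet curves: a unit-speed curve $\alpha$ is a Frenet curve for $\widehat{\nabla}$ of osculating order $r$ if there are $g$-orthonormal vector fields $E_1=\alpha',E_2,\dots,E_r$ along $\alpha$ and positive functions $\widehat{k}_1,\dots,\widehat{k}_{r-1}$ on $I$ (pseudo-Hermitian curvatures) with $\widehat{\nabla}_{E_1}E_1=\widehat{k}_1E_2$, $\widehat{\nabla}_{E_1}E_i=-\widehat{k}_{i-1}E_{i-1}+\widehat{k}_iE_{i+1}$ for $1<i<r$, and $\widehat{\nabla}_{E_1}E_r=-\widehat{k}_{r-1}E_{r-1}$ (for $r=1$: $\widehat{\nabla}_{E_1}E_1=0$); one puts $\widehat{k}_i=0$ for $i\geq r$. A pseudo-Hermitian geodesic is a Frenet curve for $\widehat{\nabla}$ of order $1$; a pseudo-Hermitian circle is one of order $2$ with $\widehat{k}_1$ constant; a pseudo-Hermitian helix of order $3$ is one of order $3$ with $\widehat{k}_1,\widehat{k}_2$ non-zero positive constants. $\phi$-curves: a pseudo-Hermitian geodesic is a pseudo-Hermitian $\phi$-curve if $\mathrm{span}\{E_1,\phi E_1,\xi\}$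 is $\phi$-invariant; a Frenet curve for $\widehat{\nabla}$ of order $2$ is a pseudo-Hermitian $\phi$-curve if $\mathrm{span}\{E_1,E_2,\xi\}$ is $\phi$-invariant; a Frenet curve for $\widehat{\nabla}$ of order $r\geq3$ is a pseudo-Hermitian $\phi$-curve if $\mathrm{span}\{E_1,\dots,E_r\}$ is $\phi$-invariant. A pseudo-Hermitian $\phi$-helix of order $r\leq3$ is a pseudo-Hermitian $\phi$-curve that is a pseudo-Hermitian geodesic ($r=1$), circle ($r=2$) or helix ($r=3$). *)

(* Defs.v *)
From HB Require Import structures.
From mathcomp Require Import all_boot all_order all_algebra.
From mathcomp Require Import all_classical all_reals all_analysis.
Set Implicit Arguments.
Unset Strict Implicit.
Unset Printing Implicit Defensive.
Import Order.TTheory GRing.Theory Num.Theory.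
Import numFieldNormedType.Exports.
Local Open Scope classical_set_scope.
Local Open Scope ring_scope.

(* C^k on an open set U of a finite-dimensional space V. Since V has finite
   dimension, x |-> 'd f x is differentiable as soon as x |-> 'D_v f x is for
   every fixed v, so iterated Frechet derivatives need no spaces of
   multilinear maps. *)
Fixpoint Ck {R : realType} {V W : normedModType R} (k : nat) (U : set V)
    (f : V -> W) : Prop :=
  match k with
  | 0%N => forall x, U x -> {for x, continuous f}
  | k'.+1 => (forall x, U x -> differentiable f x) /\
             (forall v, Ck k' U (fun x => 'D_v f x))
  end.

Definition smooth_on {R : realType} {V W : normedModType R} (U : set V)
  (f : V -> W) : Prop := forall k, Ck k U f.

(* cmap and cinv are total functions, meaningful on cdom and ccod only. *)
Record chart (R : realType) (m : nat) (M : topologicalType) := Chart {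
  cdom : set M;
  ccod : set 'rV[R]_m;
  cmap : M -> 'rV[R]_m;
  cinv : 'rV[R]_m -> M;
  cdom_open : open cdom;
  ccod_open : open ccod;
  cmap_cod : forall p, cdom p -> ccod (cmap p);
  cinv_dom : forall x, ccod x -> cdom (cinv x);
  cmapK : forall p, cdom p -> cinv (cmap p) = p;
  cinvK : forall x, ccod x -> cmap (cinv x) = x;
  cmap_continuous : forall p, cdom p -> {for p, continuous cmap};
  cinv_continuous : forall x, ccod x -> {for x, continuous cinv}
}.

(* A smooth m-manifold given by an atlas (atl c), c : ix. A preferred chart
   atl (ix_at p) is chosen at each point p; it only serves to represent the
   tangent space at p by R^m. *)
Record manifold (R : realType) (m : nat) := Manifold {
  mpoint :> topologicalType;
  mpoint_hausdorff : hausdorff_space mpoint;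
  mpoint_second_countable : @second_countable mpoint;
  ix : Type;
  atl : ix -> chart R m mpoint;
  ix_at : mpoint -> ix;
  ix_atP : forall p, cdom (atl (ix_at p)) p;
  transition_smooth : forall c c',
    smooth_on [set x | ccod (atl c) x /\ cdom (atl c') (cinv (atl c) x)]
              (cmap (atl c') \o cinv (atl c))
}.

Section Manifold.
Context {R : realType} {m : nat} {N : manifold R m}.
Implicit Types (p : N) (c : ix N) (W : set N).

(* Tangent vectors at p are given by their coordinates in the preferred
   chart at p. *)
Definition tangent p : Type := 'rV[R]_m.

Definition chart_at p := atl (ix_at p).

(* The coordinates of v : tangent p in the chart c (for p in its domain). *)
Definition coord c p (v : tangent p) : 'rV[R]_m :=
  'D_v (cmap (atl c) \o cinv (chart_at p)) (cmap (chart_at p) p).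

Definition vfield := forall p, tangent p.

Definition smooth_fun W (f : N -> R) : Prop :=
  forall c, smooth_on [set x | ccod (atl c) x /\ W (cinv (atl c) x)]
                      (f \o cinv (atl c)).

Definition smooth_vfield W (X : vfield) : Prop :=
  forall c, smooth_on [set x | ccod (atl c) x /\ W (cinv (atl c) x)]
              (fun x => coord c (X (cinv (atl c) x))).

Definition dfun (f : N -> R) p (u : tangent p) : R :=
  'D_u (f \o cinv (chart_at p)) (cmap (chart_at p) p).

(* Derivative in the direction u of the components of Y in the preferred
   chart at p; it depends on that chart, unlike lie and covD below. *)
Definition flatD (Y : vfield) p (u : tangent p) : tangent p :=
  'D_u (fun x => coord (ix_at p) (Y (cinv (chart_at p) x)))
       (cmap (chart_at p) p).

Definition lie (X Y : vfield) : vfield :=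
  fun p => flatD Y (X p) - flatD X (Y p).

(* An affine connection D is recorded by its Christoffel symbols: A p u v is
   D_u V at p for the field V with constant components v in the preferred
   chart at p, so D_u Y = flatD Y u + A p u (Y p). *)
Definition christoffel := forall p, tangent p -> tangent p -> tangent p.

Definition covD (A : christoffel) (Y : vfield) p (u : tangent p) : tangent p :=
  flatD Y u + A p u (Y p).

Definition bitensor := forall p, tangent p -> tangent p -> R.

Record affine_connection (A : christoffel) : Prop := {
  conn_linearl : forall p v, linear (fun u => A p u v);
  conn_linearr : forall p u, linear (A p u);
  conn_smooth : forall W X Y, open W ->
    smooth_vfield W X -> smooth_vfield W Y ->
    smooth_vfield W (fun p => covD A Y (X p))
}.

Record riemannian (g : bitensor) : Prop := {
  riem_linearl : forall p a (u v w : tangent p),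
    g p (a *: u + v) w = a * g p u w + g p v w;
  riem_sym : forall p u v, g p u v = g p v u;
  riem_pos : forall p u, u != 0 -> 0 < g p u u;
  riem_smooth : forall W X Y, open W ->
    smooth_vfield W X -> smooth_vfield W Y ->
    smooth_fun W (fun p => g p (X p) (Y p))
}.

Record levi_civita (g : bitensor)
    (A : christoffel) : Prop := {
  lc_connection : affine_connection A;
  lc_torsion_free : forall W X Y, open W ->
    smooth_vfield W X -> smooth_vfield W Y ->
    forall p, W p -> covD A Y (X p) - covD A X (Y p) = lie X Y p;
  lc_metric : forall W X Y Z, open W ->
    smooth_vfield W X -> smooth_vfield W Y -> smooth_vfield W Z ->
    forall p, W p -> dfun (fun q => g q (Y q) (Z q)) (X p) =
      g p (covD A Y (X p)) (Z p) + g p (Y p) (covD A Z (X p))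
}.

Implicit Types (I : set R) (alpha : R -> N).

Definition smooth_curve I alpha : Prop :=
  (forall t, I t -> {for t, continuous alpha}) /\
  (forall c, smooth_on [set t | I t /\ cdom (atl c) (alpha t)]
                       (cmap (atl c) \o alpha)).

Definition velocity alpha (t : R) : tangent (alpha t) :=
  derive1 (cmap (chart_at (alpha t)) \o alpha) t.

Definition cfield alpha := forall t, tangent (alpha t).

Definition smooth_cfield I alpha (V : cfield alpha) : Prop :=
  forall c, smooth_on [set t | I t /\ cdom (atl c) (alpha t)]
                      (fun t => coord c (V t)).

(* Covariant derivative along alpha, in the preferred chart at alpha t. *)
Definition covD_along (A : christoffel) alpha (V : cfield alpha) (t : R) :
    tangent (alpha t) :=
  derive1 (fun s => coord (ix_at (alpha t)) (V s)) t +
  A (alpha t) (velocity alpha t) (V t).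

End Manifold.

Arguments tangent {R m N} p.
Arguments vfield {R m} N.
Arguments christoffel {R m} N.
Arguments bitensor {R m} N.

(* Tensor identities below are required for vector fields defined on
   arbitrary open subsets W, as usual for local identities. *)
Record acm (R : realType) (m : nat) (N : manifold R m) := Acm {
  phi : forall p : N, {linear tangent p -> tangent p};
  xi : vfield N;
  eta : forall p : N, {scalar tangent p};
  g : bitensor N;
  phi_smooth : forall W X, open W -> smooth_vfield W X ->
    smooth_vfield W (fun p => phi p (X p));
  xi_smooth : smooth_vfield setT xi;
  eta_smooth : forall W X, open W -> smooth_vfield W X ->
    smooth_fun W (fun p => eta p (X p));
  g_riemannian : riemannian g;
  phi_phi : forall p (X : tangent p), phi p (phi p X) = - X + eta p X *: xi p;
  eta_xi : forall p, eta p (xi p) = 1;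
  phi_xi : forall p, phi p (xi p) = 0;
  eta_phi : forall p (X : tangent p), eta p (phi p X) = 0;
  g_xi : forall p (X : tangent p), @g p X (xi p) = eta p X;
  g_phi : forall p (X Y : tangent p),
    @g p X Y = @g p (phi p X) (phi p Y) + eta p X * eta p Y
}.

Arguments g {R m N} a p u v : rename.

Section Sasakian.
Context {R : realType} {m : nat} {N : manifold R m}.
Variable S : acm N.

Let phiF (X : vfield N) : vfield N := fun p => phi S p (X p).

Definition deta (X Y : vfield N) (p : N) : R :=
  2^-1 * (dfun (fun q => eta S q (Y q)) (X p)
          - dfun (fun q => eta S q (X q)) (Y p) - eta S p (lie X Y p)).

Definition nijenhuis (X Y : vfield N) (p : N) : tangent p :=
  phiF (phiF (lie X Y)) p + lie (phiF X) (phiF Y) p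
  - phiF (lie (phiF X) Y) p - phiF (lie X (phiF Y)) p.

Definition contact_metric : Prop :=
  forall W X Y, open W -> smooth_vfield W X -> smooth_vfield W Y ->
  forall p, W p -> deta X Y p = g S p (X p) (phi S p (Y p)).

Definition sasakian : Prop :=
  contact_metric /\
  forall W X Y, open W -> smooth_vfield W X -> smooth_vfield W Y ->
  forall p, W p -> nijenhuis X Y p = (- 2 * deta X Y p) *: xi S p.

Definition tanaka_webster (nabla : christoffel N) : christoffel N :=
  fun p X Y => nabla p X Y + eta S p X *: phi S p Y + eta S p Y *: phi S p X
               - g S p (phi S p X) Y *: xi S p.

Definition unit_speed (I : set R) (alpha : R -> N) : Prop :=
  smooth_curve I alpha /\
  forall t, I t -> g S (alpha t) (velocity alpha t) (velocity alpha t) = 1.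

Definition eta_velocity (alpha : R -> N) (t : R) : R :=
  eta S (alpha t) (velocity alpha t).

Definition contact_angle (I : set R) (alpha : R -> N) (theta : R) : Prop :=
  0 <= theta <= pi /\ forall t, I t -> eta_velocity alpha t = cos theta.

Definition slant (I : set R) (alpha : R -> N) : Prop :=
  unit_speed I alpha /\ exists theta, contact_angle I alpha theta.

Definition legendre (I : set R) (alpha : R -> N) : Prop :=
  unit_speed I alpha /\ forall t, I t -> eta_velocity alpha t = 0.

Variable nabla : christoffel N.

Notation hnabla := (covD_along (tanaka_webster nabla)).

Definition magnetic (I : set R) (alpha : R -> N) (q : R) : Prop :=
  unit_speed I alpha /\
  forall t, I t -> hnabla (velocity alpha) t =
    (- q + 2 * eta_velocity alpha t) *: phi S (alpha t) (velocity alpha t).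

(* The frame is E 1, ..., E r and the curvatures are k 1, ..., k (r - 1);
   E i is irrelevant for other i, and k i = 0 for r <= i. *)
Record frenet (r : nat) (I : set R) (alpha : R -> N)
    (E : nat -> cfield alpha) (k : nat -> R -> R) : Prop := {
  frenet_unit_speed : unit_speed I alpha;
  frenet_order : (0 < r)%N;
  frenet_smooth : forall i, (0 < i <= r)%N -> smooth_cfield I (E i);
  frenet_velocity : forall t, I t -> E 1%N t = velocity alpha t;
  frenet_orthonormal : forall i j t, (0 < i <= r)%N -> (0 < j <= r)%N ->
    I t -> g S (alpha t) (E i t) (E j t) = (i == j)%:R;
  frenet_pos : forall i t, (0 < i < r)%N -> I t -> 0 < k i t;
  frenet_zero : forall i t, (r <= i)%N -> I t -> k i t = 0;
  frenet_eq : forall i t, (0 < i <= r)%N -> I t ->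
    hnabla (E i) t = (if (1 < i)%N then - k i.-1 t *: E i.-1 t else 0)
                     + (if (i < r)%N then k i t *: E i.+1 t else 0)
}.

Definition constant_on (I : set R) (f : R -> R) : Prop :=
  exists a, forall t, I t -> f t = a.

Definition geodesic (I : set R) (alpha : R -> N) (E : nat -> cfield alpha)
  (k : nat -> R -> R) : Prop := frenet 1 I E k.

Definition circle (I : set R) (alpha : R -> N) (E : nat -> cfield alpha)
  (k : nat -> R -> R) : Prop := frenet 2 I E k /\ constant_on I (k 1%N).

Definition helix3 (I : set R) (alpha : R -> N) (E : nat -> cfield alpha)
    (k : nat -> R -> R) : Prop :=
  [/\ frenet 3 I E k, constant_on I (k 1%N) & constant_on I (k 2%N)].

Definition phi_invariant (p : N) (s : seq (tangent p)) : Prop :=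
  forall v : tangent p, v \in span s -> phi S p v \in span s.

Definition phi_frame (r : nat) (alpha : R -> N) (E : nat -> cfield alpha)
    (t : R) : seq (tangent (alpha t)) :=
  match r with
  | 1%N => [:: E 1%N t; phi S (alpha t) (E 1%N t); xi S (alpha t)]
  | 2%N => [:: E 1%N t; E 2%N t; xi S (alpha t)]
  | _ => [seq E i t | i <- iota 1 r]
  end.

Definition phi_curve (r : nat) (I : set R) (alpha : R -> N)
    (E : nat -> cfield alpha) (k : nat -> R -> R) : Prop :=
  frenet r I E k /\ forall t, I t -> phi_invariant (phi_frame r E t).

Definition phi_helix (r : nat) (I : set R) (alpha : R -> N)
    (E : nat -> cfield alpha) (k : nat -> R -> R) : Prop :=
  phi_curve r I E k /\
  [\/ r = 1%N /\ geodesic I E k, r = 2%N /\ circle I E k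
    | r = 3%N /\ helix3 I E k].

Definition vertical_case (I : set R) (alpha : R -> N) (e : R) : Prop :=
  (e = 1 \/ e = - 1) /\ forall t, I t -> eta_velocity alpha t = e.

Definition slant_geodesic_case (I : set R) (alpha : R -> N)
    (k : nat -> R -> R) : Prop :=
  forall t, I t -> eta_velocity alpha t \notin [:: - 1; 0; 1] /\ k 1%N t = 0.

Definition legendre_case (I : set R) (alpha : R -> N)
    (k : nat -> R -> R) : Prop :=
  forall t, I t -> eta_velocity alpha t = 0 /\ k 1%N t <> 0.

Definition slant_helix_case (I : set R) (alpha : R -> N)
    (k : nat -> R -> R) : Prop :=
  forall t, I t ->
    eta_velocity alpha t = Num.sg (eta_velocity alpha t) * k 2%N t
                           / Num.sqrt (k 1%N t ^+ 2 + k 2%N t ^+ 2)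
    /\ k 2%N t <> 0.

End Sasakian.

(* Main.v *)
Require Import Defs.
From mathcomp Require Import all_boot all_order all_algebra.
From mathcomp Require Import all_classical all_reals all_analysis.
From mathcomp Require Import ring lra.
Set Implicit Arguments.
Unset Strict Implicit.
Unset Printing Implicit Defensive.
Import Order.TTheory GRing.Theory Num.Theory.
Import numFieldNormedType.Exports.
Local Open Scope classical_set_scope.
Local Open Scope ring_scope.

(** The Tanaka-Webster connection makes [eta] parallel: for every smooth field V
    along the curve, the derivative of eta(V) is eta of the covariant derivative
    of V ([derive_eta_along]). Applied to the Frenet frame this turns the Frenet
    equations into equations for the numbers h_i = eta(E_i),
      h_i' = - k_(i-1) h_(i-1) + k_i h_(i+1)      ([derive_eta_frenet]),
    from which all h_i are found once h_1 is known to be constant.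

    The rest is linear algebra in the span of the frame. If that span is
    invariant under [phi] and contains xi in a suitable position, then
    [phi E_1], being orthogonal to E_1 and to xi, must be a multiple of E_2
    ([reeb_in_frame_phi]), of length sin(theta). The first Frenet equation then
    is the magnetic equation, and the strength is read off from the
    coefficient ([magnetic_of_phi_E2]). Order 3 is impossible for a Legendre
    curve because [phi] is a complex structure on the orthogonal complement of
    xi ([horizontal_frame3_not_invariant]). Conversely, on a magnetic curve of
    non-zero strength h_1 is constant and E_2 is a multiple of [phi E_1]; the
    equations for the h_i then leave only the listed cases
    ([magnetic_order1], [magnetic_order2], [magnetic_order3]). The signs delta
    and epsilon are constant because the functions whose signs they are take
    their values in {-s, 0, s} ([constant_of_three_values]).

    That [eta] is parallel amounts to nabla_X xi = - phi X ([g_nabla_xi]), which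
    has to be derived from the definition of a Sasakian structure. The contact
    condition determines the skew-symmetric part of nabla xi
    ([contact_nabla_xi]). Its symmetric part vanishes because xi is a Killing
    field: normality gives that the flow of xi preserves [phi] ([lie_xi_phi]),
    and Cartan's formula with d d = 0 gives that it preserves the exterior
    derivative of [eta] ([lie_xi_deta]). The latter rests on the symmetry of
    second derivatives ([derive_symmetric]). All of this is tested on
    coordinate fields, whose smoothness in every chart comes from the closure
    of C^k maps under composition ([Ck_comp]). *)

(** * C^k maps *)

Section Calculus.
Context {R : realType}.
Implicit Types V W U : normedModType R.

Lemma near_eq_differentiable V W (f h : V -> W) x :
  (\near x, f x = h x) -> differentiable f x -> differentiable h x.
Proof.
move=> fh df.
have fhx : f x = h x := nbhs_singleton fh.
have lf := diff_locally df.
have E : h \o shift x = cst (h x) + 'd f x +o_ (0 : V) id.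
  apply/eqaddoP => e e0.
  have /eqaddoP/(_ e e0) := lf.
  have fh0 : \forall y \near (0 : V), f (y + x) = h (y + x).
    have c0 : (fun y : V => y + x) @ (0 : V) --> x.
      by rewrite -[X in _ --> X]add0r; apply: cvgD; [exact: cvg_id|exact: cvg_cst].
    exact: (c0 _ fh).
  move=> H; apply: filterS2 fh0 H => y fhy.
  by rewrite !fctE /= fhy fhx.
have c := diff_continuous df.
by apply/diff_locallyP; rewrite (diff_unique c E).
Qed.

Lemma derive_comp V U W (h : V -> U) (f : U -> W) x v :
  differentiable h x -> differentiable f (h x) ->
  'D_v (f \o h) x = 'D_('D_v h x) f (h x).
Proof.
move=> dh df; rewrite deriveE; last exact: differentiable_comp.
by rewrite diff_comp //= [in RHS]deriveE // [in RHS]deriveE.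
Qed.

Lemma derive_linear V W (f : V -> W) x : differentiable f x ->
  linear (fun v => 'D_v f x).
Proof. by move=> df a u v; rewrite !deriveE // linearP. Qed.

Lemma differentiable_rV V m (f : V -> 'rV[R]_m) x :
  (forall j, differentiable (fun y => f y 0 j) x) -> differentiable f x.
Proof.
move=> df.
have -> : f = \sum_(j < m) (fun y => f y 0 j *: delta_mx 0 j).
  by apply/funext => y; rewrite {1}(row_sum_delta (f y)) fct_sumE.
by apply: differentiable_sum => j; apply: differentiableZl.
Qed.

Lemma differentiable_rVE V m (f : V -> 'rV[R]_m) x j :
  differentiable f x -> differentiable (fun y => f y 0 j) x.
Proof.
move=> df.
by apply: (differentiable_comp (g := fun N : 'rV[R]_m => N 0 j)) => //;
   exact: differentiable_coord.
Qed.

Lemma derive_rV V m (f : V -> 'rV[R]_m) x v j : differentiable f x ->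
  ('D_v f x) 0 j = 'D_v (fun y => f y 0 j) x.
Proof. by move=> /diff_derivable-/(_ v)/derive_mx ->; rewrite mxE. Qed.

Lemma Ck_ext V W k (D : set V) (f h : V -> W) : open D ->
  (forall x, D x -> f x = h x) -> Ck k D f -> Ck k D h.
Proof.
move=> oD; elim: k f h => [|k IH] f h fh.
  move=> cf x Dx; have := cf x Dx; rewrite /prop_for /continuous_at -fh // => H.
  apply: cvg_trans H; apply: near_eq_cvg.
  by near=> y; apply: fh; near: y; exact: open_nbhs_nbhs.
move=> [df cf]; split=> [x Dx|v].
  apply: near_eq_differentiable (df x Dx).
  by near=> y; apply: fh; near: y; exact: open_nbhs_nbhs.
apply: IH (cf v) => x Dx; apply: near_eq_derive.
by near=> y; apply: fh; near: y; exact: open_nbhs_nbhs.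
Unshelve. all: by end_near.
Qed.

Lemma Ck_sub V W k (D D' : set V) (f : V -> W) :
  D' `<=` D -> Ck k D f -> Ck k D' f.
Proof.
move=> sD; elim: k f => [|k IH] f; first by move=> cf x /sD /cf.
by move=> [df cf]; split=> [x /sD /df//|v]; apply: IH; exact: cf.
Qed.

Lemma Ck_prev V W k (D : set V) (f : V -> W) : Ck k.+1 D f -> Ck k D f.
Proof.
elim: k f => [|k IH] f [df cf]; last by split=> // v; apply: IH; exact: cf.
by move=> x Dx; apply: differentiable_continuous; apply: df.
Qed.

Lemma Ck_cst V W k (D : set V) (a : W) : Ck k D (fun _ : V => a).
Proof.
elim: k a => [|k IH] a; first by move=> x _; exact: cvg_cst.
split=> [x _|v]; first exact: differentiable_cst.
have -> : (fun x => 'D_v (fun _ : V => a) x) = (fun=> 0).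
  by apply/funext => x; exact: derive_cst.
exact: IH.
Qed.

Lemma CkD V W k (D : set V) (f h : V -> W) : open D ->
  Ck k D f -> Ck k D h -> Ck k D (fun x => f x + h x).
Proof.
move=> oD; elim: k f h => [|k IH] f h.
  by move=> cf ch x Dx; apply: cvgD; [exact: cf|exact: ch].
move=> [df cf] [dh ch]; split=> [x Dx|v].
  by apply: differentiableD; [exact: df|exact: dh].
apply: Ck_ext (IH _ _ (cf v) (ch v)) => // x Dx.
by rewrite -deriveD //; apply: diff_derivable; [exact: df|exact: dh].
Qed.

Lemma CkM V k (D : set V) (f h : V -> R) : open D ->
  Ck k D f -> Ck k D h -> Ck k D (fun x => f x * h x).
Proof.
move=> oD; elim: k f h => [|k IH] f h.
  by move=> cf ch x Dx; apply: cvgM; [exact: cf|exact: ch].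
move=> Cf Ch; have [df cf] := Cf; have [dh ch] := Ch.
split=> [x Dx|v].
  by apply: differentiableM; [exact: df|exact: dh].
apply: Ck_ext (CkD _ (IH _ _ (Ck_prev Cf) (ch v)) (IH _ _ (Ck_prev Ch) (cf v))) => // x Dx.
by rewrite [RHS]deriveM //; apply: diff_derivable; [exact: df|exact: dh].
Qed.

Lemma Ck_sum V k (D : set V) n (f : 'I_n -> V -> R) : open D ->
  (forall i, Ck k D (f i)) -> Ck k D (fun x => \sum_(i < n) f i x).
Proof.
move=> oD; elim: n f => [|n IH] f cf.
  by apply: Ck_ext (Ck_cst _ _ _) => // x _; rewrite big_ord0.
apply: (@Ck_ext _ _ _ _ (fun x => f ord0 x + \sum_(i < n) f (lift ord0 i) x)).
- by [].
- by move=> x _; rewrite big_ord_recl.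
- by apply: CkD => //; exact: IH.
Qed.

Lemma Ck_coord V m k (D : set V) (f : V -> 'rV[R]_m) j : open D ->
  Ck k D f -> Ck k D (fun x => f x 0 j).
Proof.
move=> oD; elim: k f => [|k IH] f.
  move=> cf x Dx; apply: (@continuous_comp _ _ _ f (fun N : 'rV[R]_m => N 0 j)).
    exact: cf.
  exact: differentiable_continuous (differentiable_coord _ _ _).
move=> [df cf]; split=> [x Dx|v]; first by apply: differentiable_rVE; exact: df.
by apply: Ck_ext (IH _ (cf v)) => // x Dx; apply: derive_rV; exact: df.
Qed.

(** Regularity is a componentwise matter, which reduces vector-valued maps to
    scalar ones, where products are available. *)
Lemma Ck_rV V m k (D : set V) (f : V -> 'rV[R]_m) : open D ->
  (forall j, Ck k D (fun x => f x 0 j)) -> Ck k D f.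
Proof.
move=> oD; elim: k f => [|k IH] f cf.
  move=> x Dx; rewrite /prop_for /continuous_at.
  rewrite (_ : f = fun y => \sum_(j < m) f y 0 j *: delta_mx 0 j); last first.
    by apply/funext => y; exact: row_sum_delta.
  apply: cvg_big => [|j _]; first exact: add_continuous.
  by apply: cvgZr_tmp; exact: cf.
split=> [x Dx|v].
  by apply: differentiable_rV => j; exact: (cf j).1.
apply: IH => j; apply: Ck_ext ((cf j).2 v) => // x Dx.
by rewrite derive_rV //; apply: differentiable_rV => i; exact: (cf i).1.
Qed.

(** Partial derivatives determine all directional ones; this is what lets
    iterated directional derivatives of a composite be computed. *)
Lemma derive_delta m W (f : 'rV[R]_m -> W) x v : differentiable f x ->
  'D_v f x = \sum_(i < m) v 0 i *: 'D_(delta_mx 0 i) f x.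
Proof.
move=> df; rewrite deriveE // {1}(row_sum_delta v) linear_sum.
by apply: eq_bigr => i _; rewrite linearZ deriveE.
Qed.

(** By induction on the order: the directional derivative of the composite is
    a sum of products of the components of the derivative of [h] with the
    partial derivatives of [f] taken at [h x], to which the induction
    hypothesis applies. *)
Lemma Ck_comp V m k (D : set V) (D' : set 'rV[R]_m) (h : V -> 'rV[R]_m)
  (f : 'rV[R]_m -> R) : open D -> (forall x, D x -> D' (h x)) ->
  Ck k D h -> Ck k D' f -> Ck k D (f \o h).
Proof.
move=> oD DD'; elim: k f => [|k IH] f.
  by move=> ch cf x Dx; apply: continuous_comp; [exact: ch|apply: cf; exact: DD'].
move=> Ch [df cf]; have [dh ch] := Ch; split=> [x Dx|v].
  by apply: differentiable_comp; [exact: dh|apply: df; exact: DD'].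
apply: (@Ck_ext _ _ _ _ (fun x => \sum_(i < m)
    'D_v h x 0 i * 'D_(delta_mx 0 i) f (h x))) => // [x Dx|].
  have dfx : differentiable f (h x) by apply: df; exact: DD'.
  by rewrite (derive_comp v (dh _ Dx) dfx) [RHS]derive_delta.
apply: Ck_sum => // i; apply: CkM => //.
  by apply: Ck_coord => //; exact: ch.
apply: (IH ('D_(delta_mx 0 i) f)); [exact: (Ck_prev (conj dh ch : Ck k.+1 D h))|exact: cf].
Qed.

Lemma Ck_comp_rV V m n k (D : set V) (D' : set 'rV[R]_m) (h : V -> 'rV[R]_m)
  (f : 'rV[R]_m -> 'rV[R]_n) : open D -> open D' ->
  (forall x, D x -> D' (h x)) ->
  Ck k D h -> Ck k D' f -> Ck k D (f \o h).
Proof.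
move=> oD oD' DD' ch cf; apply: Ck_rV => // j.
by apply: (Ck_comp oD DD' ch (f := fun y => f y 0 j)); exact: Ck_coord.
Qed.

End Calculus.

(** * Symmetry of second derivatives *)

Section Schwarz.
Context {R : realType} {V : normedModType R}.
Implicit Types (F : V -> R) (x y u v : V).

Lemma derive_line y u (t : R) :
  differentiable (fun s : R => y + s *: u) t /\
  'D_1 (fun s : R => y + s *: u) t = u.
Proof.
have dl : differentiable (fun s : R => s *: u) t by exact: differentiableZl.
split; first by apply: differentiableD.
have dc : differentiable (fun _ : R => y) t by exact: differentiable_cst.
rewrite [LHS](deriveD (diff_derivable dc) (diff_derivable dl)).
rewrite derive_cst add0r deriveE // diffZl //=.
by rewrite (diff_val (f := id)) ?scale1r.
Qed.

Lemma mean_value_line F y u (h : R) : 0 < h ->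
  (forall t, 0 <= t <= h -> differentiable F (y + t *: u)) ->
  exists2 c, 0 < c < h & F (y + h *: u) - F y = h * 'D_u F (y + c *: u).
Proof.
move=> h0 dF; pose l := fun s : R => y + s *: u.
have dFl t : 0 <= t <= h -> differentiable (F \o l) t.
  by move=> th; apply: differentiable_comp; [exact: (derive_line y u t).1|exact: dF].
have [||c ch] := @MVT R (F \o l) (fun t => 'D_u F (l t)) 0 h h0.
- move=> t; rewrite in_itv /= => /andP[t0 th].
  have t0h : 0 <= t <= h by rewrite !ltW.
  split; first exact/diff_derivable/dFl.
  by rewrite derive_comp; [rewrite (derive_line y u t).2|exact: (derive_line y u t).1|exact: dF].
- apply: continuous_in_subspaceT => t; rewrite inE /= in_itv /= => th.
  exact/differentiable_continuous/dFl.
rewrite /= /l scale0r addr0 subr0 => ->; exists c; last by rewrite mulrC.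
by move: ch; rewrite in_itv.
Qed.

(** Two applications of the mean value theorem, first along [u] to the
    increment of [F] in the direction [v], then along [v] to the derivative
    of [F] in the direction [u]. *)
Lemma second_difference F (D : set V) x u v (h : R) : 0 < h -> Ck 2 D F ->
  (forall s t, 0 <= s <= h -> 0 <= t <= h -> D (x + s *: u + t *: v)) ->
  exists s t, [/\ 0 < s < h, 0 < t < h &
    F (x + h *: u + h *: v) - F (x + h *: u) - (F (x + h *: v) - F x)
    = h * (h * 'D_v (fun y => 'D_u F y) (x + s *: u + t *: v))].
Proof.
move=> h0 [dF cF] Dst.
have hh : 0 <= h <= h by apply/andP; split => //; exact: ltW.
have zh : 0 <= (0 : R) <= h by apply/andP; split => //; exact: ltW.
have Ds s : 0 <= s <= h -> D (x + s *: u).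
  by move=> /Dst/(_ zh); rewrite scale0r addr0.
pose G := (F \o (fun y => y + h *: v)) - F.
have dsh y : differentiable (fun y => y + h *: v) y by exact: differentiableD.
have Dsh y w : 'D_w (fun y => y + h *: v) y = w.
  by rewrite deriveD // derive_id derive_cst addr0.
have dFh s : 0 <= s <= h -> differentiable (F \o (fun y => y + h *: v)) (x + s *: u).
  by move=> sh; apply: differentiable_comp => //; apply: dF; exact: Dst.
have dG s : 0 <= s <= h -> differentiable G (x + s *: u).
  by move=> sh; apply: differentiableB; [exact: dFh|apply: dF; exact: Ds].
have [s sh Es] := mean_value_line h0 dG.
have s0h : 0 <= s <= h by case/andP: sh => /ltW-> /ltW->.
have dF1 t : 0 <= t <= h ->
    differentiable (fun y => 'D_u F y) (x + s *: u + t *: v).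
  by move=> th; apply: (cF u).1; exact: Dst.
have [t th Et] := mean_value_line h0 dF1.
exists s, t; split => //; rewrite -Et.
rewrite (_ : 'D_u F (x + s *: u + h *: v) - 'D_u F (x + s *: u) = 'D_u G (x + s *: u)).
  by rewrite -Es /G /= !fctE /=.
rewrite (deriveB (diff_derivable (dFh _ s0h)) (diff_derivable (dF _ (Ds _ s0h)))).
have dFv : differentiable F (x + s *: u + h *: v) by apply: dF; exact: Dst.
by rewrite (derive_comp u (dsh _) dFv) Dsh.
Qed.

(** Both mixed derivatives are limits of the same second difference, which is
    symmetric in [u] and [v]: if they differed at [x], continuity would keep
    them apart on a ball around [x], while on a small enough parallelogram
    they take a common value. *)
Lemma derive_symmetric F (D : set V) x u v : open D -> D x -> Ck 2 D F ->
  'D_u (fun y => 'D_v F y) x = 'D_v (fun y => 'D_u F y) x.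
Proof.
move=> oD Dx cF; apply/eqP/negPn/negP => ab.
set a := fun y => 'D_u (fun y => 'D_v F y) y.
set b := fun y => 'D_v (fun y => 'D_u F y) y.
pose e := `|a x - b x| / 2.
have e0 : 0 < e by rewrite divr_gt0 // normr_gt0 subr_eq0.
have ca : {for x, continuous a} by exact: ((cF.2 v).2 u).
have cb : {for x, continuous b} by exact: ((cF.2 u).2 v).
have : \forall y \near x, [/\ D y, `|a x - a y| < e & `|b x - b y| < e].
  have na := @cvgr_dist_lt _ _ _ _ _ _ _ ca e e0.
  have nb := @cvgr_dist_lt _ _ _ _ _ _ _ cb e e0.
  have nD : nbhs x D by exact: open_nbhs_nbhs.
  have FF : Filter (nbhs x) by exact: nbhs_filter.
  by apply: filterS3 nD (na FF) (nb FF) => y Dy ay by_; exact: (And3 Dy ay by_).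
move=> /nbhs_ballP[d /= d0 dab].
(* This side length keeps the parallelogram inside the ball of radius d. *)
pose K := `|u| + `|v| + 1.
have K0 : 0 < K by rewrite ltr_wpDl // addr_ge0.
pose h := d / K.
have h0 : 0 < h by rewrite divr_gt0.
have inb s t : 0 <= s <= h -> 0 <= t <= h -> ball x d (x + s *: u + t *: v).
  move=> /andP[s0 sh] /andP[t0 th]; rewrite -ball_normE /= -addrA opprD addrA subrr sub0r normrN.
  apply: (le_lt_trans (ler_normD _ _)); rewrite !normrZ !ger0_norm //.
  have /le_lt_trans -> // : s * `|u| + t * `|v| <= h * (`|u| + `|v|).
    by rewrite mulrDr lerD // ler_wpM2r.
  by rewrite mulrAC ltr_pdivrMr // ltr_pM2l // ltrDl.
have Dst s t (sh : 0 <= s <= h) (th : 0 <= t <= h) : D (x + s *: u + t *: v).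
  by have [] := dab _ (inb s t sh th).
have Dts s t (sh : 0 <= s <= h) (th : 0 <= t <= h) : D (x + s *: v + t *: u).
  by rewrite addrAC; exact: Dst.
have [s [t [sh th E1]]] := second_difference h0 cF Dst.
have [s' [t' [sh' th' E2]]] := second_difference h0 cF Dts.
have W r : 0 < r < h -> 0 <= r <= h by case/andP => /ltW-> /ltW->.
have [_ _ B] := dab _ (inb _ _ (W _ sh) (W _ th)).
have [_ A _] := dab _ (inb _ _ (W _ th') (W _ sh')).
have E : a (x + t' *: u + s' *: v) = b (x + s *: u + t *: v).
  have hn : h != 0 by rewrite gt_eqF.
  apply: (mulfI hn); apply: (mulfI hn).
  have swap (p q r w : R) : p - q - (r - w) = p - r - (q - w) by ring.
  rewrite (addrAC x (t' *: u)); apply: etrans (esym E2) (etrans _ E1).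
  by rewrite (addrAC x (h *: v)) swap.
have : `|a x - b x| < e + e.
  have -> : a x - b x = (a x - a (x + t' *: u + s' *: v)) - (b x - b (x + s *: u + t *: v)).
    by rewrite E opprB addrA subrK.
  exact: le_lt_trans (ler_normB _ _) (ltrD A B).
by rewrite /e -splitr ltxx.
Qed.

End Schwarz.

(** * Coordinate vector fields *)

Local Opaque derive.

Local Notation coord := Defs.coord.

Section CoordinateFields.
Context {R : realType} {m : nat} {N : manifold R m}.
Implicit Types (p q : N) (c : ix N) (u v w : 'rV[R]_m).

Definition trans c c' : 'rV[R]_m -> 'rV[R]_m := cmap (atl c') \o cinv (atl c).

Definition dtrans c c' p u : 'rV[R]_m := 'D_u (trans c c') (cmap (atl c) p).

(** The coordinate field of [c] with constant components [u] in that chart.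
    Since tangent vectors at [p] are recorded in the chart preferred at [p],
    these components must be transported there. *)
Definition coord_field c u : vfield N := fun p => dtrans c (ix_at p) p u.

Lemma open_chart_preim c (W : set N) : open W ->
  open [set x | ccod (atl c) x /\ W (cinv (atl c) x)].
Proof.
move=> oW; rewrite openE => x [cx Wx]; rewrite /interior /=.
have cc := cinv_continuous cx.
have nc : nbhs x (ccod (atl c)) by apply: open_nbhs_nbhs; split => //; exact: ccod_open.
have nW : nbhs (cinv (atl c) x) W by apply: open_nbhs_nbhs; split.
exact: filterI nc (cc _ nW).
Qed.

Lemma nbhs_chart_preim c p (W : set N) : cdom (atl c) p -> open W -> W p ->
  \forall x \near cmap (atl c) p, ccod (atl c) x /\ W (cinv (atl c) x).
Proof.
move=> cp oW Wp; apply: open_nbhs_nbhs; split; first exact: open_chart_preim.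
by split; [exact: cmap_cod|rewrite cmapK].
Qed.

Lemma trans_cmap c c' p : cdom (atl c) p ->
  trans c c' (cmap (atl c) p) = cmap (atl c') p.
Proof. by move=> cp; rewrite /trans /= cmapK. Qed.

Lemma differentiable_trans c c' p : cdom (atl c) p -> cdom (atl c') p ->
  differentiable (trans c c') (cmap (atl c) p).
Proof.
move=> cp c'p; have [dt _] := transition_smooth c c' 1.
by apply: dt; split; [exact: cmap_cod|rewrite cmapK].
Qed.

(** The chain rule in the form used for every change of chart: [H] and [F] are
    the expressions of one map in the charts [c] and [c']. *)
Lemma derive_trans c c' p u (T : normedModType R) (F : 'rV[R]_m -> T)
    (H : 'rV[R]_m -> T) : cdom (atl c) p -> cdom (atl c') p ->
  (\forall x \near cmap (atl c) p, H x = F (trans c c' x)) ->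
  differentiable F (cmap (atl c') p) ->
  'D_u H (cmap (atl c) p) = 'D_(dtrans c c' p u) F (cmap (atl c') p).
Proof.
move=> cp c'p HF; rewrite -(trans_cmap c' cp) => dF.
by rewrite (near_eq_derive _ HF) (derive_comp u (differentiable_trans cp c'p) dF).
Qed.

Lemma dtrans_comp c c' c'' p u : cdom (atl c) p -> cdom (atl c') p ->
  cdom (atl c'') p ->
  dtrans c' c'' p (dtrans c c' p u) = dtrans c c'' p u.
Proof.
move=> cp c'p c''p; rewrite {1}/dtrans.
rewrite -(@derive_trans _ _ _ _ _ _ (trans c c'')) //.
  apply: filterS (nbhs_chart_preim cp (cdom_open _) c'p) => x [cx c'x].
  by rewrite /trans /= (cmapK c'x).
exact: differentiable_trans.
Qed.

Lemma dtrans_id c p u : cdom (atl c) p -> dtrans c c p u = u.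
Proof.
move=> cp; rewrite /dtrans -[RHS](derive_id (cmap (atl c) p)).
apply: near_eq_derive.
apply: filterS (nbhs_chart_preim cp (cdom_open _) cp) => x [cx _].
by rewrite /trans /= cinvK.
Qed.

Lemma coordE c p (v : tangent p) : coord c v = dtrans (ix_at p) c p v.
Proof. by []. Qed.

Lemma coord_preferred p (v : tangent p) : coord (ix_at p) v = v.
Proof. by rewrite coordE dtrans_id //; exact: ix_atP. Qed.

Lemma coord_coord_field c c' p u : cdom (atl c) p -> cdom (atl c') p ->
  coord c' (coord_field c u p) = dtrans c c' p u.
Proof. by move=> cp c'p; rewrite coordE dtrans_comp //; exact: ix_atP. Qed.

Lemma coord_field_coord c p (v : tangent p) : cdom (atl c) p ->
  coord_field c (coord c v) p = v.
Proof.
move=> cp; rewrite /coord_field coordE dtrans_comp ?dtrans_id //; exact: ix_atP.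
Qed.

Lemma coord_field_preferred p u : coord_field (ix_at p) u p = u.
Proof. by rewrite /coord_field dtrans_id //; exact: ix_atP. Qed.

(** In another chart the components of a coordinate field are a directional
    derivative of a transition map, composed with the inverse transition. *)
Lemma coord_field_smooth c u : smooth_vfield (cdom (atl c)) (coord_field c u).
Proof.
move=> c' k.
have oD := @open_chart_preim c' _ (cdom_open (atl c)).
have oD' := @open_chart_preim c _ (cdom_open (atl c')).
apply: (@Ck_ext _ _ _ _ _ ((fun x => 'D_u (trans c c') x) \o trans c' c)) => //.
  move=> x [c'x cx]; rewrite (coord_coord_field u cx (cinv_dom c'x)) /=.
  by rewrite /dtrans /trans /=.
apply: (Ck_comp_rV oD oD') (transition_smooth c' c k) _ => [x [c'x cx]|].
  by split; [exact: cmap_cod|rewrite /trans /= cmapK //; exact: cinv_dom].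
exact: (transition_smooth c c' k.+1).2.
Qed.

Lemma flatD_coord_field c p u v : cdom (atl c) p ->
  flatD (coord_field c v) (coord_field c u p) =
  'D_u (fun x => 'D_v (trans c (ix_at p)) x) (cmap (atl c) p).
Proof.
move=> cp; have ip := ix_atP p; pose i := ix_at p.
have [_ /(_ v)[dt _]] := transition_smooth c i 2.
have dF : differentiable ('D_v (trans c i)) (cmap (atl c) p).
  by apply: dt; split; [exact: cmap_cod|rewrite cmapK].
have HF : \forall x \near cmap (atl i) p,
    coord i (coord_field c v (cinv (atl i) x)) = 'D_v (trans c i) (trans i c x).
  apply: filterS (nbhs_chart_preim ip (cdom_open _) cp) => x [ix cx].
  exact: coord_coord_field cx (cinv_dom ix).
have Eu : dtrans (ix_at p) c p (coord_field c u p) = u.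
  exact: etrans (dtrans_comp u cp ip cp) (dtrans_id u cp).
apply: etrans (derive_trans (coord_field c u p) ip cp HF dF) _.
by rewrite Eu.
Qed.

(** The field is constant in the very chart in which the derivative is taken. *)
Lemma flatD_coord_field_preferred p u v :
  flatD (coord_field (ix_at p) v) (u : tangent p) = 0.
Proof.
have ip := ix_atP p.
rewrite -[u](coord_field_preferred p) flatD_coord_field //.
have H : \forall x \near cmap (chart_at p) p,
    'D_v (trans (ix_at p) (ix_at p)) x = cst v x.
  apply: filterS (nbhs_chart_preim ip (cdom_open _) ip) => x [ix cx].
  by rewrite -[X in 'D_v _ X](cinvK ix) -[RHS](dtrans_id v cx).
rewrite (near_eq_derive u H).
exact: derive_cst.
Qed.

(** In the chart preferred at [p], which need not be [c], the bracket is the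
    difference of the two mixed second derivatives of a transition map. *)
Lemma lie_coord_field c p u v : cdom (atl c) p ->
  lie (coord_field c u) (coord_field c v) p = 0.
Proof.
move=> cp; rewrite /lie !flatD_coord_field //; apply/eqP; rewrite subr_eq0.
apply/eqP; have ip := ix_atP p; set i := ix_at p in ip *.
have Ct := transition_smooth c i 2.
set D := (X in Ck 2 X _) in Ct.
have oD : open D by apply: open_chart_preim; exact: cdom_open.
have Dp : D (cmap (atl c) p) by split; [exact: cmap_cod|rewrite cmapK].
apply/rowP => j.
have dt w : differentiable (fun x => 'D_w (trans c i) x) (cmap (atl c) p).
  by apply: (Ct.2 w).1.
apply: etrans (derive_rV u j (dt v)) (etrans _ (esym (derive_rV v j (dt u)))).
have E w w' : 'D_w (fun y => 'D_w' (trans c i) y 0 j) (cmap (atl c) p) =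
    'D_w (fun y => 'D_w' (fun z => trans c i z 0 j) y) (cmap (atl c) p).
  apply: near_eq_derive; apply: filterS (open_nbhs_nbhs (conj oD Dp)) => y Dy.
  exact: derive_rV (Ct.1 _ Dy).
apply: etrans (E u v) (etrans _ (esym (E v u))).
apply: (derive_symmetric u v oD Dp).
exact: (@Ck_coord _ _ m 2 D (trans c i) j oD Ct).
Qed.

Lemma dfun_coord_field c p u (W : set N) (f : N -> R) : cdom (atl c) p -> W p ->
  smooth_fun W f ->
  dfun f (coord_field c u p) = 'D_u (f \o cinv (atl c)) (cmap (atl c) p).
Proof.
move=> cp Wp sf; have ip := ix_atP p; rewrite /dfun.
have dF : differentiable (f \o cinv (atl c)) (cmap (atl c) p).
  by apply: (sf c 1%N).1; split; [exact: cmap_cod|rewrite cmapK].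
have HF : \forall x \near cmap (chart_at p) p,
    (f \o cinv (chart_at p)) x = (f \o cinv (atl c)) (trans (ix_at p) c x).
  apply: filterS (nbhs_chart_preim ip (cdom_open _) cp) => x [ix cx].
  by rewrite /trans /= cmapK.
have Eu : dtrans (ix_at p) c p (coord_field c u p) = u.
  exact: etrans (dtrans_comp u cp ip cp) (dtrans_id u cp).
apply: etrans (derive_trans (coord_field c u p) ip cp HF dF) _.
by rewrite Eu.
Qed.

Lemma coord_field_sum c p v : cdom (atl c) p ->
  coord_field c v p = \sum_i v 0 i *: coord_field c (delta_mx 0 i) p.
Proof.
by move=> cp; apply: derive_delta; exact: differentiable_trans cp (ix_atP p).
Qed.

End CoordinateFields.

(** * The exterior derivative of a 1-form *)

Section Cartan.
Context {R : realType} {m : nat}.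
Implicit Types (th : 'rV[R]_m -> 'rV[R]_m -> R) (u v w x : 'rV[R]_m).

Local Notation e_ i := (delta_mx 0 i : 'rV[R]_m).

(** The exterior derivative of a 1-form, evaluated on two constant vectors; [th]
    gives the value of the form on each constant vector field, and no factor
    one half is used here. *)
Definition dform th u w : 'rV[R]_m -> R := fun x => 'D_u (th w) x - 'D_w (th u) x.

Lemma dform_diff (D : set 'rV[R]_m) th u w x : (forall w, Ck 2 D (th w)) -> D x ->
  differentiable (dform th u w) x.
Proof.
move=> sth Dx.
exact: differentiableB (((sth w).2 u).1 _ Dx) (((sth u).2 w).1 _ Dx).
Qed.

Lemma derive_dform (D : set 'rV[R]_m) th u w v x : (forall w, Ck 2 D (th w)) -> D x ->
  'D_v (dform th u w) x = 'D_v ('D_u (th w)) x - 'D_v ('D_w (th u)) x.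
Proof.
move=> sth Dx.
exact: deriveB (diff_derivable (((sth w).2 u).1 _ Dx))
                (diff_derivable (((sth u).2 w).1 _ Dx)).
Qed.

(** Leibniz rule applied to the vanishing contraction of the exterior
    derivative with [X]. *)
Lemma derive_contraction (D : set 'rV[R]_m) th (X : 'rV[R]_m -> 'rV[R]_m) u w x :
  open D -> D x -> (forall w, Ck 2 D (th w)) -> Ck 1 D X ->
  (forall y, D y -> \sum_i X y 0 i * dform th (e_ i) w y = 0) ->
  \sum_i ('D_u X x) 0 i * dform th (e_ i) w x =
  - \sum_i X x 0 i * ('D_u ('D_(e_ i) (th w)) x - 'D_u ('D_w (th (e_ i))) x).
Proof.
move=> oD Dx sth [dX _] X0.
have dXi i : differentiable (fun y => X y 0 i) x := differentiable_rVE i (dX _ Dx).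
have df i := dform_diff (e_ i) w sth Dx.
have near0 : \forall y \near x,
    (\sum_i (fun y => X y 0 i) * dform th (e_ i) w) y = cst (0 : R) y.
  apply: filterS (open_nbhs_nbhs (conj oD Dx)) => y Dy.
  by rewrite fct_sumE; exact: X0.
have := near_eq_derive u near0; rewrite derive_cst derive_sum; last first.
  by move=> i; apply: derivableM; exact: diff_derivable.
move=> E0; apply/eqP; rewrite -subr_eq0 opprK -big_split /=; apply/eqP.
apply: etrans E0; apply: eq_bigr => i _.
rewrite (deriveM (diff_derivable (dXi i)) (diff_derivable (df i))).
rewrite (derive_dform _ _ _ sth Dx) (derive_rV u i (dX _ Dx)).
by rewrite addrC; congr (_ + _); rewrite mulrC.
Qed.

(** Cartan's formula, with d d = 0: the Lie derivative of an exact 2-form along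
    [X] is the exterior derivative of its contraction with [X], hence zero
    when this contraction vanishes. In coordinates, everything cancels by
    symmetry of second derivatives. *)
Lemma lie_derivative_dform (D : set 'rV[R]_m) th (X : 'rV[R]_m -> 'rV[R]_m) u w x :
  open D -> D x -> (forall w, Ck 2 D (th w)) -> Ck 1 D X ->
  (forall w y, D y -> \sum_i X y 0 i * dform th (e_ i) w y = 0) ->
  'D_(X x) (dform th u w) x + \sum_i ('D_u X x) 0 i * dform th (e_ i) w x
    + \sum_i ('D_w X x) 0 i * dform th u (e_ i) x = 0.
Proof.
move=> oD Dx sth cX X0.
rewrite (derive_contraction u oD Dx sth cX (X0 w)).
have -> : \sum_i ('D_w X x) 0 i * dform th u (e_ i) x =
    - \sum_i ('D_w X x) 0 i * dform th (e_ i) u x.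
  by rewrite -sumrN; apply: eq_bigr => i _; rewrite -mulrN opprB.
rewrite (derive_contraction w oD Dx sth cX (X0 u)) opprK.
rewrite (derive_delta (X x) (dform_diff u w sth Dx)) -sumrN -!big_split /=.
apply: big1 => i _; rewrite (derive_dform _ _ _ sth Dx).
have S1 := derive_symmetric (e_ i) u oD Dx (sth w).
have S2 := derive_symmetric (e_ i) w oD Dx (sth u).
have S3 := derive_symmetric u w oD Dx (sth (e_ i)).
rewrite [_ *: _]/(_ * _).
move: S1 S2 S3.
move: ('D_(e_ i) ('D_u (th w)) x) ('D_u ('D_(e_ i) (th w)) x)
  ('D_(e_ i) ('D_w (th u)) x) ('D_w ('D_(e_ i) (th u)) x)
  ('D_u ('D_w (th (e_ i))) x) ('D_w ('D_u (th (e_ i))) x) (X x 0 i).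
move=> a1 a2 b1 b2 c1 c2 z -> -> ->.
by rewrite -!mulrN -!mulrDr (_ : _ + _ = 0) ?mulr0 //; ring.
Qed.

End Cartan.

(** * The Levi-Civita derivative of the Reeb field *)

Section AlmostContact.
Context {R : realType} {m : nat} {N : manifold R m} (S : acm N).
Implicit Types (p : N) (a : R).

Lemma gDl p (u v w : tangent p) : g S p (u + v) w = g S p u w + g S p v w.
Proof.
by have := riem_linearl (g_riemannian S) 1 u v w; rewrite scale1r mul1r.
Qed.

Lemma g0l p (w : tangent p) : g S p (0 : 'rV[R]_m) w = 0.
Proof.
have := gDl 0 0 w; rewrite addr0 => /eqP.
by rewrite -[X in X == _]addr0 (inj_eq (addrI _)) => /eqP <-.
Qed.

Lemma gZl p a (u w : tangent p) : g S p (a *: u) w = a * g S p u w.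
Proof.
by have := riem_linearl (g_riemannian S) a u 0 w; rewrite addr0 g0l addr0.
Qed.

Lemma gNl p (u w : tangent p) : g S p (- u : 'rV[R]_m) w = - g S p u w.
Proof. by rewrite -scaleN1r gZl mulN1r. Qed.

Lemma gC p (u v : tangent p) : g S p u v = g S p v u.
Proof. exact: (riem_sym (g_riemannian S)). Qed.

Lemma gDr p (u v w : tangent p) : g S p w (u + v) = g S p w u + g S p w v.
Proof. by rewrite gC gDl !(gC w). Qed.

Lemma gZr p a (u w : tangent p) : g S p w (a *: u) = a * g S p w u.
Proof. by rewrite gC gZl (gC w). Qed.

Lemma gNr p (u w : tangent p) : g S p w (- u : 'rV[R]_m) = - g S p w u.
Proof. by rewrite gC gNl (gC w). Qed.

Lemma g_suml p n (F : 'I_n -> tangent p) (w : tangent p) :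
  g S p (\sum_i F i) w = \sum_i g S p (F i) w.
Proof.
elim: n F => [|n IH] F; first by rewrite !big_ord0 g0l.
by rewrite !big_ord_recl gDl IH.
Qed.

Lemma g_eq0 p (u : tangent p) : g S p u u = 0 -> u = 0.
Proof.
move=> gu; apply/eqP/negPn/negP => u0.
by have := riem_pos (g_riemannian S) p u0; rewrite gu ltxx.
Qed.

Lemma etaD p (u v : tangent p) : eta S p (u + v) = eta S p u + eta S p v.
Proof. by rewrite -!g_xi gDl. Qed.

Lemma etaZ p a (u : tangent p) : eta S p (a *: u) = a * eta S p u.
Proof. by rewrite -!g_xi gZl. Qed.

Lemma etaN p (u : tangent p) : eta S p (- u : 'rV[R]_m) = - eta S p u.
Proof. by rewrite -!g_xi gNl. Qed.

Lemma g_phi_skew p (u v : tangent p) :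
  g S p (phi S p u) v = - g S p u (phi S p v).
Proof.
rewrite g_phi eta_phi mul0r addr0 phi_phi gDl gNl gZl (gC (xi S p)) g_xi eta_phi.
by rewrite mulr0 addr0.
Qed.

Lemma g_phi_self p (u : tangent p) : g S p (phi S p u) u = 0.
Proof.
have := g_phi_skew u u; rewrite (gC u) => /eqP.
by rewrite -addr_eq0 -mulr2n mulrn_eq0 => /eqP.
Qed.

End AlmostContact.

Section ReebField.
Context {R : realType} {m : nat} {N : manifold R m} (S : acm N).
Variables (nabla : christoffel N) (p : N).
Hypotheses (sasS : sasakian S) (lcN : levi_civita (g S) nabla).

Local Notation c := (ix_at p).
Local Notation W := (cdom (atl c)).
Local Notation cf := (coord_field c).
Local Notation dxi u := (covD nabla (xi S) (u : tangent p)).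

Let oW : open W := cdom_open _.
Let Wp : W p := ix_atP p.

Let cfp u : cf u p = u := coord_field_preferred p u.

Let scf u : smooth_vfield W (cf u) := coord_field_smooth c u.

Lemma smooth_vfieldS (U U' : set N) (X : vfield N) : U' `<=` U ->
  smooth_vfield U X -> smooth_vfield U' X.
Proof.
by move=> sU sX c' k; apply: Ck_sub (sX c' k) => x [cx /sU].
Qed.

Let sxi : smooth_vfield W (xi S) := smooth_vfieldS (@subsetT _ _) (xi_smooth S).

Let sphi u : smooth_vfield W (fun q => phi S q (cf u q)) := phi_smooth S oW (scf u).

Lemma flatD_linear (U : set N) (Y : vfield N) (q : N) : smooth_vfield U Y -> U q ->
  linear (fun u : 'rV[R]_m => flatD Y (u : tangent q) : 'rV[R]_m).
Proof.
move=> sY Uq; apply: derive_linear; apply: (sY (ix_at q) 1%N).1.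
split; first exact: cmap_cod (ix_atP q).
by rewrite (cmapK (ix_atP q)).
Qed.

Lemma nabla_xi_linear : linear (fun u : 'rV[R]_m => dxi u : 'rV[R]_m).
Proof.
move=> a u v; rewrite /covD (flatD_linear sxi Wp).
rewrite (conn_linearl (lc_connection lcN) (xi S p) a u v).
rewrite addrACA -scalerDr.
by [].
Qed.

Lemma dfun_cst (k : R) (f : N -> R) q (u : tangent q) :
  (forall x, f x = k) -> dfun f u = 0.
Proof.
move=> fk; rewrite /dfun (_ : f \o _ = cst k) ?derive_cst //.
by apply/funext => x /=.
Qed.

Lemma eta_fun (Y : vfield N) :
  (fun q => eta S q (Y q)) = (fun q => g S q (Y q) (xi S q)).
Proof. by apply/funext => q; rewrite g_xi. Qed.

(** The Reeb field has unit length. *)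
Lemma nabla_xi_horizontal (u : tangent p) : g S p (dxi u) (xi S p) = 0.
Proof.
have := lc_metric lcN oW (scf u) sxi sxi Wp.
rewrite (dfun_cst (k := 1)) => [|q]; last by rewrite g_xi eta_xi.
rewrite (gC _ (xi S p)) -mulr2n cfp => /esym/eqP.
by rewrite mulrn_eq0 => /eqP.
Qed.

Lemma covD_coord_field (u v : tangent p) : covD nabla (cf v) u = @nabla p u v.
Proof. by rewrite /covD flatD_coord_field_preferred add0r cfp. Qed.

Lemma nabla_sym (u v : tangent p) : @nabla p u v = @nabla p v u.
Proof.
have := lc_torsion_free lcN oW (scf u) (scf v) Wp.
rewrite lie_coord_field // !cfp !covD_coord_field => /eqP.
by rewrite subr_eq0 => /eqP.
Qed.

(** The contact condition fixes the skew-symmetric part of the derivative of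
    the Reeb field. Coordinate fields are used so that brackets vanish. *)
Lemma contact_nabla_xi (u v : tangent p) :
  2 * g S p u (phi S p v) = g S p v (dxi u) - g S p u (dxi v).
Proof.
have := sasS.1 _ _ _ oW (scf u) (scf v) _ Wp.
rewrite /deta lie_coord_field // linear0 subr0 !eta_fun.
rewrite (lc_metric lcN oW (scf u) (scf v) sxi Wp).
rewrite (lc_metric lcN oW (scf v) (scf u) sxi Wp).
rewrite !cfp !covD_coord_field (nabla_sym v u) => <-.
by rewrite opprD addrACA subrr add0r mulVKf.
Qed.

Lemma nabla_xi_xi (v : tangent p) : g S p v (dxi (xi S p)) = 0.
Proof.
have := contact_nabla_xi (xi S p) v.
rewrite gC g_xi eta_phi mulr0 (gC S (xi S p)) nabla_xi_horizontal subr0.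
by move=> <-.
Qed.

Lemma flatD0 (Y : vfield N) (q : N) : flatD Y (0 : tangent q) = 0.
Proof. exact: derive0. Qed.

Lemma lie0 (Y : vfield N) (q : N) : lie (fun q => 0 : tangent q) Y q = 0.
Proof.
rewrite /lie flatD0 sub0r /flatD (_ : (fun x => _) = cst 0) ?derive_cst ?oppr0 //.
by apply/funext => x; exact: derive0.
Qed.

(** Normality, evaluated on the Reeb field and one more field, shows that [phi]
    kills the difference of the two sides; so this difference is vertical, and
    both sides are horizontal, the left one because the contraction of the
    exterior derivative of [eta] with the Reeb field vanishes. *)
Lemma lie_xi_phi u :
  lie (xi S) (fun q => phi S q (cf u q)) p = phi S p (lie (xi S) (cf u) p).
Proof.
set Y := fun q => phi S q (cf u q).
have := sasS.2 _ _ _ oW sxi (scf u) _ Wp.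
rewrite (sasS.1 _ _ _ oW sxi (scf u) _ Wp) gC g_xi eta_phi mulr0 scale0r.
rewrite /nijenhuis (_ : (fun q => phi S q (xi S q)) = fun q => 0); last first.
  by apply/functional_extensionality_dep => q; exact: phi_xi.
rewrite !lie0 linear0 subr0 addr0 -/Y => /eqP; rewrite subr_eq0 => /eqP E.
have eY : eta S p (lie (xi S) Y p) = 0.
  have := sasS.1 _ _ _ oW sxi (sphi u) _ Wp.
  rewrite -/Y gC g_xi eta_phi /deta.
  rewrite (dfun_cst (k := 0)) => [|q]; last exact: eta_phi.
  rewrite (dfun_cst (k := 1)) => [|q]; last exact: eta_xi.
  by rewrite subr0 sub0r => /eqP; rewrite mulf_eq0 invr_eq0 pnatr_eq0 /= oppr_eq0 => /eqP.
have := congr1 (phi S p) E; rewrite [RHS]phi_phi eY scale0r addr0 phi_phi eta_phi.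
rewrite scale0r addr0 => /oppr_inj E'.
exact: esym E'.
Qed.

Let U := [set x | ccod (atl c) x /\ W (cinv (atl c) x)].
Let x0 := cmap (atl c) p.
Let oU : open U := @open_chart_preim _ _ _ c _ oW.
Let Ux0 : U x0.
Proof. by split; [exact: cmap_cod|rewrite /x0 cmapK]. Qed.

Let th w := (fun q => eta S q (cf w q)) \o cinv (atl c).
Let X x := coord c (xi S (cinv (atl c) x)).

Let dform_th u w x : U x -> dform th u w x =
  2 * g S (cinv (atl c) x) (cf u (cinv (atl c) x))
        (phi S (cinv (atl c) x) (cf w (cinv (atl c) x))).
Proof.
move=> [cx Wx]; rewrite -(sasS.1 _ _ _ oW (scf u) (scf w) _ Wx).
have two0 : (2 : R) != 0 by rewrite pnatr_eq0.
rewrite /deta (lie_coord_field _ _ Wx) linear0 subr0 (mulVKf two0).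
rewrite (dfun_coord_field u Wx Wx (eta_smooth S oW (scf w))).
rewrite (dfun_coord_field w Wx Wx (eta_smooth S oW (scf u))).
by rewrite (cinvK cx).
Qed.

Let sum_dform q (v w : 'rV[R]_m) : W q ->
  \sum_i v 0 i * dform th (delta_mx 0 i) w (cmap (atl c) q) =
  2 * g S q (cf v q) (phi S q (cf w q)).
Proof.
move=> Wq; rewrite (coord_field_sum v Wq) g_suml mulr_sumr.
apply: eq_bigr => i _; rewrite dform_th; last first.
  by split; [exact: cmap_cod|rewrite cmapK].
by rewrite cmapK // gZl mulrCA.
Qed.

(** The Lie derivative of the exterior derivative of [eta] along the Reeb field
    vanishes. On coordinate fields, the bracket with the Reeb field at [p] is
    minus the derivative of its components, whence the right-hand side. *)
Lemma lie_xi_deta (u w : tangent p) :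
  dfun (fun q => g S q (cf u q) (phi S q (cf w q))) (xi S p) =
  - g S p (flatD (xi S) u) (phi S p w) - g S p u (phi S p (flatD (xi S) w)).
Proof.
set f := fun q => _.
have X0 : X x0 = xi S p by rewrite /X /x0 cmapK // coord_preferred.
have contr w' y : U y -> \sum_i X y 0 i * dform th (delta_mx 0 i) w' y = 0.
  move=> [cy Wy]; have := sum_dform (X y) w' Wy; rewrite (cinvK cy) => ->.
  by rewrite /X coord_field_coord // gC g_xi eta_phi mulr0.
have sth w' : Ck 2 U (th w') := eta_smooth S oW (scf w') c 2%N.
have sX : Ck 1 U X := sxi c 1%N.
have L := lie_derivative_dform u w oU Ux0 sth sX contr; rewrite X0 in L.
have E1 : 'D_(xi S p) (dform th u w) x0 = 2 * dfun f (xi S p).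
  have near0 : \forall x \near x0, dform th u w x = (2 *: (f \o cinv (atl c))) x.
    by apply: filterS (open_nbhs_nbhs (conj oU Ux0)) => x Ux; rewrite dform_th.
  apply: etrans (near_eq_derive _ near0) _; apply: deriveZ.
  apply: diff_derivable.
  by apply: (riem_smooth (g_riemannian S) oW (scf u) (sphi w) c 1%N).1.
have E2 : \sum_i ('D_u X x0) 0 i * dform th (delta_mx 0 i) w x0 =
    2 * g S p (flatD (xi S) u) (phi S p w).
  by apply: etrans (sum_dform ('D_u X x0) w Wp) _; rewrite !cfp.
have E3 : \sum_i ('D_w X x0) 0 i * dform th u (delta_mx 0 i) x0 =
    2 * g S p u (phi S p (flatD (xi S) w)).
  have Esk : \sum_i ('D_w X x0) 0 i * dform th u (delta_mx 0 i) x0 =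
      - \sum_i ('D_w X x0) 0 i * dform th (delta_mx 0 i) u x0.
    by rewrite -sumrN; apply: eq_bigr => i _; rewrite -mulrN opprB.
  have E := sum_dform ('D_w X x0) u Wp; rewrite !cfp in E.
  apply: etrans Esk (etrans (congr1 -%R E) _).
  by rewrite -mulrN -g_phi_skew gC.
have := etrans (esym (congr2 +%R (congr2 +%R E1 E2) E3)) L.
rewrite -!mulrDr => /eqP; rewrite mulf_eq0 pnatr_eq0 /= -addrA addr_eq0 opprD.
by move=> /eqP.
Qed.

(** The Lie derivative along the Reeb field kills both [phi] and the form
    g(X, phi Y), hence the metric on pairs (u, phi w). Metric compatibility and
    the absence of torsion rewrite this as a Killing equation. *)
Lemma nabla_xi_skew_phi (u w : tangent p) :
  g S p (dxi u) (phi S p w) + g S p u (dxi (phi S p w)) = 0.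
Proof.
have M := lc_metric lcN oW sxi (scf u) (sphi w) Wp.
have T1 := lc_torsion_free lcN oW sxi (scf u) Wp.
have T2 := lc_torsion_free lcN oW sxi (sphi w) Wp.
rewrite lie_xi_phi in T2.
have lxi v : lie (xi S) (cf v) p = - flatD (xi S) (v : tangent p).
  by rewrite /lie flatD_coord_field_preferred sub0r cfp.
rewrite lxi linearN in T2; rewrite lxi in T1.
move: M; rewrite lie_xi_deta.
have dsub (x y z : 'rV[R]_m) : x - y = - z -> x = y - z.
  by move=> /eqP; rewrite subr_eq addrC => /eqP.
rewrite (dsub _ _ _ T1) (dsub _ _ _ T2).
rewrite !cfp gDl gDr gNl gNr addrACA [RHS]addrC => /eqP.
by rewrite -subr_eq0 opprD addNKr oppr_eq0 => /eqP.
Qed.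

(** This is nabla_X xi = - phi X. The Killing equation on pairs (u, phi w)
    extends to all pairs because every vector is the sum of a multiple of xi
    and a vector in the image of [phi]; so the symmetric part of the
    derivative of xi vanishes and the contact condition gives the rest. *)
Lemma g_nabla_xi (u v : tangent p) : g S p (dxi u) v = g S p u (phi S p v).
Proof.
have K y a : g S p (dxi u) (a *: xi S p + phi S p y) +
    g S p u (dxi (a *: xi S p + phi S p y)) = 0.
  rewrite nabla_xi_linear gDr gZr nabla_xi_horizontal mulr0 add0r.
  by rewrite gDr gZr nabla_xi_xi mulr0 add0r nabla_xi_skew_phi.
(* The horizontal part of v is in the image of phi, because phi squared is
   minus the identity there. *)
have dv : v = eta S p v *: xi S p + phi S p (- phi S p v).
  by rewrite linearN phi_phi opprD opprK addrCA subrr addr0.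
have := K (- phi S p v) (eta S p v); rewrite -dv => Kv.
have := contact_nabla_xi u v; rewrite (gC S v).
move: Kv => /eqP; rewrite addrC addr_eq0 => /eqP ->; rewrite opprK.
have two0 : (2 : R) != 0 by rewrite pnatr_eq0.
by move=> E; apply: (mulfI two0); rewrite E mulr_natl mulr2n.
Qed.

End ReebField.

(** * Derivatives along a curve *)

Lemma constant_of_derive0 {R : realType} (I : set R) (f : R -> R) :
  is_interval I ->
  (forall t, I t -> differentiable f t /\ 'D_1 f t = 0) ->
  forall s t, I s -> I t -> f s = f t.
Proof.
move=> iI df.
suff lt s t : s < t -> I s -> I t -> f s = f t.
  move=> s t Is It; have [st|ts|->//] := ltgtP s t; first exact: lt.
  by apply/esym; exact: lt.
move=> st Is It.
have inI x : s <= x <= t -> I x by move=> sxt; exact: iI Is It x sxt.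
have [||x _ E] := @MVT R f (cst 0) s t st.
- move=> x; rewrite in_itv /= => /andP[/ltW sx /ltW xt].
  have [d D] := df x (inI x (introT andP (conj sx xt))).
  by rewrite -D; apply: derivableP; exact: diff_derivable.
- apply: continuous_in_subspaceT => x; rewrite inE /= in_itv /= => /inI /df[d _].
  exact: differentiable_continuous.
by move: E; rewrite mul0r => /eqP; rewrite subr_eq0 => /eqP.
Qed.

Lemma scalar_sum {R : realType} {V : lmodType R} (b : V -> R) n (a : 'I_n -> R)
    (v : 'I_n -> V) : scalar b ->
  b (\sum_i a i *: v i) = \sum_i a i * b (v i).
Proof.
move=> lb; have b0 : b 0 = 0.
  have := lb 1 0 0; rewrite scaler0 addr0 mul1r => /eqP.
  by rewrite -[X in X == _]addr0 (inj_eq (addrI _)) => /eqP <-.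
elim/big_rec2 : _ => [//|i y x _ <-].
exact: lb.
Qed.

Lemma near_eq_derive1 {R : realType} (F G : R -> R) (t : R) :
  (\forall s \near t, F s = G s) -> differentiable F t ->
  differentiable G t /\ 'D_1 G t = 'D_1 F t.
Proof.
move=> FG dF; split; first exact: near_eq_differentiable FG dF.
apply: near_eq_derive; apply: filterS FG => s; exact: esym.
Qed.

Section Curve.
Context {R : realType} {m : nat} {N : manifold R m}.
Variables (I : set R) (alpha : R -> N).
Hypotheses (oI : open I) (sa : smooth_curve I alpha).
Implicit Types (V : cfield alpha).


Section AtTime.
Variables (t0 : R) (It0 : I t0).
Local Notation p := (alpha t0).
Local Notation c := (ix_at p).
Local Notation W := (cdom (atl c)).
Local Notation e_ i := (coord_field c (delta_mx 0 i)).

Let J := [set t | I t /\ W (alpha t)].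
Let Jt0 : J t0.
Proof. by split => //; exact: ix_atP. Qed.

Lemma near_curve_chart : \forall s \near t0, J s.
Proof.
have nI : nbhs t0 I by exact: open_nbhs_nbhs.
have nW : nbhs p W by apply: open_nbhs_nbhs; split; [exact: cdom_open|exact: ix_atP].
exact: filterI nI (sa.1 t0 It0 _ nW).
Qed.

Let gamma := cmap (atl c) \o alpha.

Let gamma_diff : differentiable gamma t0.
Proof. exact: (sa.2 c 1%N).1. Qed.

Let velocityE : velocity alpha t0 = 'D_1 gamma t0.
Proof. exact: derive1E. Qed.

Lemma derive_along_curve (f : N -> R) : smooth_fun W f ->
  differentiable (f \o alpha) t0 /\
  'D_1 (f \o alpha) t0 = dfun f (velocity alpha t0).
Proof.
move=> sf.
have df : differentiable (f \o cinv (atl c)) (gamma t0).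
  apply: (sf c 1%N).1; split; first exact: cmap_cod (ix_atP p).
  by rewrite /gamma /= (cmapK (ix_atP p)); exact: ix_atP.
have E : \forall s \near t0, ((f \o cinv (atl c)) \o gamma) s = (f \o alpha) s.
  by apply: filterS near_curve_chart => s [_ Ws]; rewrite /gamma /= (cmapK Ws).
have [d D] := near_eq_derive1 E (differentiable_comp gamma_diff df).
split; first exact: d.
apply: etrans D _; rewrite (derive_comp _ gamma_diff df) velocityE.
by [].
Qed.

(** The part of the covariant derivative along the curve that does not involve
    the connection. *)
Definition dcoord V : 'rV[R]_m := derive1 (fun s => coord c (V s)) t0.

Lemma smooth_cfield_diff V i : smooth_cfield I V ->
  differentiable (fun s => coord c (V s) 0 i) t0 /\
  'D_1 (fun s => coord c (V s) 0 i) t0 = dcoord V 0 i.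
Proof.
move=> sV; have [dV _] := sV c 1%N; have {}dV := dV _ Jt0.
split; first exact: (differentiable_rVE i dV).
by apply: etrans (esym (derive_rV _ i dV)) _; rewrite /dcoord derive1E.
Qed.

(** Near [t0] the field is a combination of coordinate fields with differentiable
    coefficients, so the product rule applies to the pairing with [b]. *)
Lemma covector_along_curve (b : forall q : N, tangent q -> R) V :
  (forall q, scalar (b q : 'rV[R]_m -> R)) -> smooth_cfield I V ->
  (forall i, smooth_fun W (fun q => b q (e_ i q))) ->
  differentiable (fun s => b (alpha s) (V s)) t0 /\
  'D_1 (fun s => b (alpha s) (V s)) t0 = b p (dcoord V) +
    \sum_i V t0 0 i * dfun (fun q => b q (e_ i q)) (velocity alpha t0).
Proof.
move=> lb sV sb.
pose vi i := fun s => coord c (V s) 0 i.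
pose bi i := (fun q => b q (e_ i q)) \o alpha.
have dv i := smooth_cfield_diff i sV.
have db i := derive_along_curve (sb i).
have dvb i : differentiable (vi i * bi i) t0.
  exact: differentiableM (dv i).1 (db i).1.
have E : \forall s \near t0, (\sum_i vi i * bi i) s = b (alpha s) (V s).
  apply: filterS near_curve_chart => s [_ Ws].
  rewrite -[in RHS](coord_field_coord (V s) Ws) (coord_field_sum _ Ws).
  by rewrite (scalar_sum _ _ (lb _)) fct_sumE.
have [d D] := near_eq_derive1 E (differentiable_sum dvb).
split; first exact: d.
apply: etrans D _; rewrite derive_sum => [|i]; last exact: diff_derivable.
rewrite (row_sum_delta (dcoord V)) (scalar_sum _ _ (lb p)).
rewrite -big_split /=.
apply: eq_bigr => i _.
rewrite (deriveM (diff_derivable (dv i).1) (diff_derivable (db i).1)).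
rewrite (dv i).2 (db i).2 addrC; congr (_ + _).
  by rewrite coord_preferred.
have B0 : bi i t0 = b p (delta_mx 0 i).
  exact (congr1 (b p) (coord_field_preferred p (delta_mx 0 i))).
apply: etrans (mulrC _ _) _; congr (_ * _); exact: B0.
Qed.

Lemma bilinear_along_curve (b : forall q : N, tangent q -> tangent q -> R) V V' :
  (forall q w, scalar (fun u : 'rV[R]_m => b q u w)) ->
  (forall q u, scalar (b q u : 'rV[R]_m -> R)) ->
  smooth_cfield I V -> smooth_cfield I V' ->
  (forall i j, smooth_fun W (fun q => b q (e_ i q) (e_ j q))) ->
  differentiable (fun s => b (alpha s) (V s) (V' s)) t0.
Proof.
move=> lbl lbr sV sV' sb.
pose vi i := fun s => coord c (V s) 0 i.
pose bi i := fun s => b (alpha s) (e_ i (alpha s)) (V' s).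
have dvb i : differentiable (vi i * bi i) t0.
  apply: differentiableM (smooth_cfield_diff i sV).1 _.
  exact: (covector_along_curve (fun q => lbr q (e_ i q)) sV' (sb i)).1.
have E : \forall s \near t0, (\sum_i vi i * bi i) s = b (alpha s) (V s) (V' s).
  apply: filterS near_curve_chart => s [_ Ws].
  rewrite -[in RHS](coord_field_coord (V s) Ws) (coord_field_sum _ Ws).
  by rewrite (scalar_sum _ _ (lbl _ _)) fct_sumE.
exact: (near_eq_derive1 E (differentiable_sum dvb)).1.
Qed.

End AtTime.

Section ContactAlongCurve.
Variables (S : acm N) (nabla : christoffel N).
Hypotheses (sasS : sasakian S) (lcN : levi_civita (g S) nabla).

Lemma g_scalarr q (w : tangent q) : scalar (g S q w : 'rV[R]_m -> R).
Proof. by move=> a u v; rewrite gDr gZr. Qed.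

(** The form [eta] is parallel for the Tanaka-Webster connection. For the
    Levi-Civita connection the derivative of [eta] contributes
    g(T, phi V) = - g(phi T, V), which is exactly the vertical correction term;
    the two remaining correction terms are horizontal. *)
Lemma derive_eta_along V t : I t -> smooth_cfield I V ->
  differentiable (fun s => eta S (alpha s) (V s)) t /\
  'D_1 (fun s => eta S (alpha s) (V s)) t =
    eta S (alpha t) (covD_along (tanaka_webster S nabla) V t).
Proof.
move=> It sV; pose c := ix_at (alpha t); have oW := cdom_open (atl c).
have Wt : cdom (atl c) (alpha t) by exact: ix_atP.
pose T : tangent (alpha t) := velocity alpha t.
have sb i : smooth_fun (cdom (atl c))
    (fun q => eta S q (coord_field c (delta_mx 0 i) q)).
  exact (eta_smooth S oW (coord_field_smooth c (delta_mx 0 i))).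
have lb q : scalar (eta S q : 'rV[R]_m -> R) by move=> a u v; exact: linearP.
have [dE E] := covector_along_curve It lb sV sb; split; first exact: dE.
rewrite E.
(* The derivative along T of eta on the coordinate field with value v: eta of
   the covariant derivative of that field, plus the derivative of eta at v. *)
pose b v := eta S (alpha t) (@nabla (alpha t) T v) + g S (alpha t) T (phi S (alpha t) v).
have lb' : scalar (b : 'rV[R]_m -> R).
  move=> a u v; rewrite /b (conn_linearr (lc_connection lcN) T a u v).
  rewrite !linearP /= gDr gZr; ring.
have Eb i : dfun (fun q => eta S q (coord_field c (delta_mx 0 i) q)) T =
    b (delta_mx 0 i).
  have M := lc_metric lcN oW (coord_field_smooth c T)
    (coord_field_smooth c (delta_mx 0 i))
    (smooth_vfieldS (@subsetT _ _) (xi_smooth S)) Wt.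
  rewrite /b eta_fun; move: M; rewrite coord_field_preferred => ->.
  rewrite covD_coord_field g_xi coord_field_preferred gC.
  by rewrite (g_nabla_xi sasS lcN).
have -> : \sum_i V t 0 i * dfun (fun q => eta S q (coord_field c (delta_mx 0 i) q)) T
    = b (V t).
  rewrite [in RHS](row_sum_delta (V t)) (scalar_sum _ _ lb').
  by apply: eq_bigr => i _; rewrite Eb.
rewrite /b /covD_along /tanaka_webster -/T.
rewrite !etaD etaN !etaZ !eta_phi eta_xi.
by rewrite !mulr0 !addr0 mulr1 g_phi_skew opprK.
Qed.

Lemma diff_g_phi_along V V' t : I t -> smooth_cfield I V -> smooth_cfield I V' ->
  differentiable (fun s => g S (alpha s) (phi S (alpha s) (V s)) (V' s)) t.
Proof.
move=> It sV sV'; have oW := cdom_open (atl (ix_at (alpha t))).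
pose b q (u v : tangent q) := g S q (phi S q u) v.
apply: (@bilinear_along_curve t It b V V') => //.
- by move=> q w a u v; rewrite /b linearP gDl gZl.
- by move=> q w; exact: g_scalarr.
move=> i j; apply: (riem_smooth (g_riemannian S) oW).
  by apply: (phi_smooth S oW); exact: coord_field_smooth.
exact: coord_field_smooth.
Qed.

End ContactAlongCurve.

End Curve.

(** * Frames in a tangent space *)

(** Differentiating f^3 = s^2 f gives (3 f^2 - s^2) f' = 0, and the first
    factor is - s^2 or 2 s^2. *)
Lemma constant_of_three_values {R : realType} (I : set R) (f : R -> R) (s : R) :
  is_interval I -> open I -> s != 0 -> (forall t, I t -> differentiable f t) ->
  (forall t, I t -> f t * (f t ^+ 2 - s ^+ 2) = 0) ->
  forall t t', I t -> I t' -> f t = f t'.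
Proof.
move=> iI oI s0 df f3; apply: constant_of_derive0 => // t It.
split; first exact: df.
have dt : derivable f t (1 : R) by exact: diff_derivable (df t It).
have E : \forall x \near t, (f * (f * f)) x = (s ^+ 2 \*: f) x.
  apply: filterS (open_nbhs_nbhs (conj oI It)) => x Ix.
  have := f3 x Ix; rewrite mulrBr => /eqP; rewrite subr_eq0 => /eqP fx.
  by apply: etrans (etrans _ fx) (mulrC _ _); rewrite expr2.
have := near_eq_derive (1 : R) E.
rewrite (deriveZ _ dt) (deriveM dt (derivableM dt dt)) (deriveM dt dt).
move=> D; have {}D : (3 * f t ^+ 2 - s ^+ 2) * 'D_1 f t = 0.
  apply: etrans (_ : f t * (f t * 'D_1 f t + f t * 'D_1 f t) +
    (f t * f t) * 'D_1 f t - s ^+ 2 * 'D_1 f t = 0); first by ring.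
  by apply/eqP; rewrite subr_eq0; apply/eqP; exact: D.
move/eqP: D; rewrite mulf_eq0 => /orP[/eqP D|/eqP //].
have s20 : s ^+ 2 != 0 by rewrite sqrf_eq0.
have /eqP := f3 t It; rewrite mulf_eq0 => /orP[/eqP ft|/eqP ft].
  by move: D s20; rewrite ft expr0n mulr0 sub0r => /eqP; rewrite oppr_eq0 => ->.
have {}D : s ^+ 2 = 0 by lra.
by rewrite D eqxx in s20.
Qed.

Section PointwiseFrames.
Context {R : realType} {m : nat} {N : manifold R m} (S : acm N).
Variable p : N.
Implicit Types (a b c v w : tangent p).

Definition orthonormal3 a b c : Prop :=
  [/\ g S p a a = 1, g S p b b = 1 & g S p c c = 1] /\
  [/\ g S p a b = 0, g S p a c = 0 & g S p b c = 0].

Lemma g_phi_phi v w :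
  g S p (phi S p v) (phi S p w) = g S p v w - eta S p v * eta S p w.
Proof. by rewrite [in RHS]g_phi addrK. Qed.

Lemma mem_span3 (a b c v : 'rV[R]_m) : v \in span [:: a; b; c] ->
  exists x y z, v = x *: a + y *: b + z *: c.
Proof.
rewrite !span_cons span_nil addv0.
move=> /memv_addP[_ /vlineP[x ->] [_ /memv_addP[_ /vlineP[y ->] [_ /vlineP[z ->] ->]] ->]].
by exists x, y, z; rewrite addrA.
Qed.

Lemma orthonormal3_expansion a b c v : orthonormal3 a b c ->
  v \in span [:: a; b; c] ->
  v = g S p v a *: a + g S p v b *: b + g S p v c *: c.
Proof.
move=> [[aa bb cc] [ab ac bc]] /mem_span3[x [y [z ->]]].
rewrite !gDl !gZl (gC S b a) (gC S c a) (gC S c b) aa bb cc ab ac bc.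
by rewrite !mulr0 !mulr1 !addr0 !add0r.
Qed.

Lemma parseval3 a b c v w : orthonormal3 a b c -> v \in span [:: a; b; c] ->
  g S p v w = g S p v a * g S p w a + g S p v b * g S p w b
              + g S p v c * g S p w c.
Proof.
move=> abc /(orthonormal3_expansion abc) vE.
by rewrite {1}vE !gDl !gZl (gC S a) (gC S b) (gC S c).
Qed.

Lemma phi_invariant3 a b c : phi_invariant S [:: a; b; c] ->
  [/\ phi S p a \in span [:: a; b; c], phi S p b \in span [:: a; b; c]
    & phi S p c \in span [:: a; b; c]].
Proof.
move=> inv; split; apply: inv; apply: memv_span; by rewrite !inE eqxx ?orbT.
Qed.

(** On the orthogonal complement of xi the map [phi] is a complex structure, so
    it preserves no subspace of dimension 3. Concretely, with x, y, z the
    entries of the skew matrix of [phi] in the frame, its rows have unit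
    length, so that x^2 = y^2 = z^2 = 1/2, while orthogonality of two of them
    forces y z = 0. *)
Lemma horizontal_frame3_not_invariant a b c : orthonormal3 a b c ->
  eta S p a = 0 -> eta S p b = 0 -> eta S p c = 0 ->
  ~ phi_invariant S [:: a; b; c].
Proof.
move=> abc ea eb ec /phi_invariant3[ia ib ic].
have [[aa bb cc] [ab ac bc]] := abc.
have Ea := parseval3 (phi S p a) abc ia.
have Eb := parseval3 (phi S p b) abc ib.
have Ec := parseval3 (phi S p c) abc ic.
have Eab := parseval3 (phi S p b) abc ia.
have ba : g S p (phi S p b) a = - g S p (phi S p a) b by rewrite g_phi_skew gC.
have ca : g S p (phi S p c) a = - g S p (phi S p a) c by rewrite g_phi_skew gC.
have cb : g S p (phi S p c) b = - g S p (phi S p b) c by rewrite g_phi_skew gC.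
move: Ea Eb Ec Eab; rewrite !g_phi_phi !g_phi_self ba ca cb ea eb ec aa bb cc ab.
move: (g S p (phi S p a) b) (g S p (phi S p a) c) (g S p (phi S p b) c).
move=> x y z; rewrite !mulr0 !mul0r !subr0 !addr0 !add0r => Ea Eb Ec Eab.
have yz : y * z = 0 by rewrite -Eab.
have y2 : y * y = 2^-1 by lra.
have z2 : z * z = 2^-1 by lra.
have : (y * z) * (y * z) = 4^-1.
  have -> : (y * z) * (y * z) = (y * y) * (z * z) by ring.
  by rewrite y2 z2; lra.
by rewrite yz; lra.
Qed.

(** By the length condition xi lies in the plane of [a] and [c], and has a
    non-zero component on [c]; as [phi a] is orthogonal to [a] and to xi, only
    its component on [b] remains. *)
Lemma reeb_in_frame_phi a b c (x z : R) : orthonormal3 a b c ->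
  phi_invariant S [:: a; b; c] ->
  eta S p a = x -> eta S p b = 0 -> eta S p c = z -> z != 0 ->
  x ^+ 2 + z ^+ 2 = 1 ->
  phi S p a = g S p (phi S p a) b *: b /\ g S p (phi S p a) b ^+ 2 = 1 - x ^+ 2.
Proof.
move=> abc /phi_invariant3[ia ib ic] ea eb ec z0 xz.
have [[aa bb cc] [ab ac bc]] := abc.
have xiE : xi S p = x *: a + z *: c.
  have D : xi S p + ((- x) *: a + (- z) *: c) = 0.
    apply: (@g_eq0 _ _ _ S p).
    rewrite !gDl !gDr !gZl !gZr !(gC S (xi S p)) !g_xi eta_xi.
    by rewrite ea ec aa cc (gC S c a) ac; lra.
  by move/eqP: D; rewrite !scaleNr -opprD subr_eq0 => /eqP.
have ca : g S p (phi S p a) c = 0.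
  have := eta_phi S a; rewrite -g_xi xiE gDr !gZr g_phi_self mulr0 add0r.
  by move=> /eqP; rewrite mulf_eq0 (negbTE z0) => /eqP.
have aE := orthonormal3_expansion abc ia.
rewrite g_phi_self ca scale0r add0r scale0r addr0 in aE.
split=> //; have := parseval3 (phi S p a) abc ia.
by rewrite g_phi_phi aa ea g_phi_self ca mulr0 add0r addr0 -!expr2 => <-.
Qed.

Lemma horizontal_frame2_phi a b : 
  g S p a a = 1 -> g S p b b = 1 -> g S p a b = 0 ->
  eta S p a = 0 -> eta S p b = 0 ->
  phi_invariant S [:: a; b; xi S p] ->
  phi S p a = g S p (phi S p a) b *: b /\ g S p (phi S p a) b ^+ 2 = 1.
Proof.
move=> aa bb ab ea eb inv.
have abc : orthonormal3 a b (xi S p) by split; split; rewrite ?g_xi ?eta_xi.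
have := reeb_in_frame_phi abc inv ea eb (eta_xi S p) (oner_neq0 _).
by rewrite expr0n expr1n add0r subr0; apply.
Qed.

End PointwiseFrames.

(** * Frenet curves of the Tanaka-Webster connection *)

Lemma covD_along_ext {R : realType} {m : nat} {N : manifold R m} (I : set R)
    (alpha : R -> N) (A : christoffel N) (V V' : cfield alpha) t :
  open I -> (forall s, I s -> V s = V' s) -> I t ->
  covD_along A V t = covD_along A V' t.
Proof.
move=> oI VV' It.
have VV'_near : \forall s \near t,
    coord (ix_at (alpha t)) (V s) = coord (ix_at (alpha t)) (V' s).
  by apply: filterS (open_nbhs_nbhs (conj oI It)) => s Is; rewrite (VV' s Is).
have D := etrans (derive1E _ _) (etrans (near_eq_derive _ VV'_near) (esym (derive1E _ _))).
have F := congr1 (A (alpha t) (velocity alpha t)) (VV' t It).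
exact (congr2 (fun x y : 'rV[R]_m => x + y) D F).
Qed.

Section FrenetCurves.
Context {R : realType} {m : nat} {N : manifold R m}.
Variables (S : acm N) (nabla : christoffel N) (I : set R) (alpha : R -> N).
Variables (r : nat) (E : nat -> cfield alpha) (k : nat -> R -> R).
Hypotheses (sasS : sasakian S) (lcN : levi_civita (g S) nabla).
Hypotheses (oI : open I) (iI : is_interval I) (I0 : I !=set0).
Hypothesis frE : frenet S nabla r I E k.

Local Notation hnabla := (covD_along (tanaka_webster S nabla)).
Local Notation H i := (fun t => eta S (alpha t) (E i t)).

Let sa : smooth_curve I alpha := (frenet_unit_speed frE).1.

Lemma eta_velocityE t : I t -> eta_velocity S alpha t = H 1%N t.
Proof. by move=> It; rewrite /eta_velocity -(frenet_velocity frE It). Qed.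

Lemma frenet_unit i t : (0 < i <= r)%N -> I t -> g S (alpha t) (E i t) (E i t) = 1.
Proof. by move=> ir It; rewrite (frenet_orthonormal frE ir ir It) eqxx. Qed.

Lemma frenet_orth i j t : (0 < i <= r)%N -> (0 < j <= r)%N -> i != j -> I t ->
  g S (alpha t) (E i t) (E j t) = 0.
Proof. by move=> ir jr ij It; rewrite (frenet_orthonormal frE ir jr It) (negbTE ij). Qed.

Lemma hnabla_velocity t : I t -> hnabla (velocity alpha) t = hnabla (E 1%N) t.
Proof.
move=> It; have vE s : I s -> velocity alpha s = E 1%N s.
  by move=> Is; rewrite (frenet_velocity frE Is).
exact (covD_along_ext (V := velocity alpha) _ oI vE It).
Qed.

(** Since [eta] is parallel, its values on the frame satisfy the scalar Frenet
    equations. *)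
Lemma derive_eta_frenet i t : (0 < i <= r)%N -> I t ->
  differentiable (H i) t /\
  'D_1 (H i) t = (if (1 < i)%N then - k i.-1 t * H i.-1 t else 0)
               + (if (i < r)%N then k i t * H i.+1 t else 0).
Proof.
move=> ir It; have [d D] := derive_eta_along oI sa sasS lcN It (frenet_smooth frE ir).
split; first exact: d.
apply: etrans D _; rewrite (frenet_eq frE ir It) etaD.
by congr (_ + _); case: ifP => _; rewrite ?etaZ // linear0.
Qed.

Lemma eta_frenet_const i (e : R) : (0 < i <= r)%N ->
  (forall t, I t -> H i t = e) -> forall t, I t ->
  (if (1 < i)%N then - k i.-1 t * H i.-1 t else 0)
    + (if (i < r)%N then k i t * H i.+1 t else 0) = 0.
Proof.
move=> ir He t It; have [_ <-] := derive_eta_frenet ir It.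
have near_e : \forall s \near t, H i s = cst e s.
  by apply: filterS (open_nbhs_nbhs (conj oI It)) => s Is; exact: He.
exact: etrans (near_eq_derive _ near_e) (derive_cst _ _ _).
Qed.

Lemma frenet_order1 : (forall t, I t -> k 1%N t = 0) -> r = 1%N.
Proof.
move=> k0; have [t It] := I0; have r0 := frenet_order frE.
case: (ltnP 1 r) => [r1|r1]; last by apply/eqP; rewrite eqn_leq r1.
by have := frenet_pos frE (i := 1%N) r1 It; rewrite k0 // ltxx.
Qed.

Lemma eta1_const_order1 : r = 1%N -> forall s t, I s -> I t -> H 1%N s = H 1%N t.
Proof.
move=> r1; apply: constant_of_derive0 => // t It.
have [d D] := derive_eta_frenet (i := 1%N) (eq_leq (esym r1)) It.
by split=> //; rewrite D r1 /= addr0.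
Qed.

Lemma frame3_orthonormal t : r = 3%N -> I t ->
  orthonormal3 S (E 1%N t) (E 2%N t) (E 3%N t).
Proof.
by move=> r3 It; split; split; rewrite ?frenet_unit ?frenet_orth // r3.
Qed.

(** The scalar Frenet equations propagate the vanishing of [eta] from E_1 to E_2
    and E_3. *)
Lemma horizontal_helix3 : r = 3%N -> phi_curve S nabla r I E k ->
  (forall t, I t -> H 1%N t = 0) -> False.
Proof.
move=> r3 [_ inv] H1; have [t It] := I0.
have H2 s : I s -> H 2%N s = 0.
  move=> Is; have := eta_frenet_const (i := 1%N) _ H1 Is.
  rewrite r3 /= add0r => /(_ isT)/eqP; rewrite mulf_eq0 => /orP[/eqP k1|/eqP//].
  by have := frenet_pos frE (i := 1%N) _ Is; rewrite k1 ltxx r3 => /(_ isT).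
have H3 : H 3%N t = 0.
  have := eta_frenet_const (i := 2%N) _ H2 It.
  rewrite r3 /= H1 // mulr0 add0r => /(_ isT)/eqP.
  rewrite mulf_eq0 => /orP[/eqP k2|/eqP//].
  by have := frenet_pos frE (i := 2%N) _ It; rewrite k2 ltxx r3 => /(_ isT).
have := inv t It; rewrite r3 /=.
by apply: horizontal_frame3_not_invariant (H1 t It) (H2 t It) H3; exact: frame3_orthonormal.
Qed.

Lemma diff_delta t : (1 < r)%N -> I t ->
  differentiable (fun s => g S (alpha s) (phi S (alpha s) (E 1%N s)) (E 2%N s)) t.
Proof.
move=> r1 It; have r0 : (0 < r)%N by exact: ltnW.
apply: (diff_g_phi_along oI sa S It (frenet_smooth frE _) (frenet_smooth frE _)).
  by rewrite r0.
by rewrite r1.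
Qed.

Lemma g_velocity t : I t -> g S (alpha t) (velocity alpha t) (velocity alpha t) = 1.
Proof. exact: (frenet_unit_speed frE).2. Qed.

Lemma eta_velocity_sq t : I t ->
  g S (alpha t) (phi S (alpha t) (velocity alpha t)) (phi S (alpha t) (velocity alpha t))
  = 1 - eta_velocity S alpha t ^+ 2.
Proof. by move=> It; rewrite g_phi_phi g_velocity // expr2. Qed.

Lemma eta_velocity_bound t : I t -> -1 <= eta_velocity S alpha t <= 1.
Proof.
move=> It; rewrite -ler_norml -(ler_pXn2r (n := 2)) ?nnegrE // expr1n.
rewrite real_normK ?num_real // -subr_ge0 -eta_velocity_sq //.
have [->|u0] := eqVneq (phi S (alpha t) (velocity alpha t)) 0; first by rewrite g0l.
by apply: ltW; exact: (riem_pos (g_riemannian S) (alpha t) u0).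
Qed.

Lemma vertical_velocity e t : (e = 1 \/ e = -1) -> I t ->
  eta_velocity S alpha t = e -> velocity alpha t = e *: xi S (alpha t).
Proof.
move=> e1 It He; set T := velocity alpha t.
have D : T + (- e) *: xi S (alpha t) = 0.
  apply: (@g_eq0 _ _ _ S (alpha t)); rewrite !gDl !gDr !gZl !gZr (gC S (xi _ _)) !g_xi eta_xi.
  rewrite g_velocity // -/(eta_velocity S alpha t) He.
  by case: e1 => ->; lra.
by move/eqP: D; rewrite scaleNr subr_eq0 => /eqP.
Qed.

(** If E_1 = e xi, the other frame vectors are orthogonal to xi; the scalar
    Frenet equation for E_2 then reads k_1 e = 0. *)
Lemma vertical_order1 e : (r <= 3)%N -> vertical_case S I alpha e -> r = 1%N.
Proof.
move=> r3 [e1 He]; have [t It] := I0; have r0 := frenet_order frE.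
have e0 : e != 0 by case: e1 => ->; rewrite ?oppr_eq0 oner_eq0.
apply/eqP; rewrite eqn_leq r0 andbT leqNgt; apply/negP => r1.
have H1 s : I s -> H 1%N s = e by move=> Is; rewrite -eta_velocityE // He.
have Hj j s : (1 < j <= r)%N -> I s -> H j s = 0.
  move=> /andP[j1 jr] Is; have vE := vertical_velocity e1 Is (He s Is).
  have := frenet_orth (i := j) (j := 1%N) _ _ _ Is.
  rewrite (ltnW j1) jr r0 (gtn_eqF j1) => /(_ isT isT isT).
  rewrite (frenet_velocity frE Is) vE gZr g_xi => /eqP.
  by rewrite mulf_eq0 (negbTE e0) => /eqP.
have H2 s : I s -> H 2%N s = 0 by apply: Hj; rewrite r1.
have := eta_frenet_const (i := 2%N) _ H2 It; rewrite r1 /= H1 // => /(_ isT).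
have -> : (if (2 < r)%N then k 2%N t * H 3%N t else 0) = 0.
  by case: ifP => // r2; rewrite Hj ?mulr0.
rewrite addr0 => /eqP; rewrite mulf_eq0 (negbTE e0) orbF oppr_eq0 => /eqP k1.
by have := frenet_pos frE (i := 1%N) r1 It; rewrite k1 ltxx.
Qed.

Lemma order1_hnabla t : r = 1%N -> I t -> hnabla (velocity alpha) t = 0.
Proof.
move=> r1 It; rewrite hnabla_velocity // (frenet_eq frE) ?r1 //=.
exact: addr0.
Qed.

Lemma vertical_magnetic e q : (r <= 3)%N -> vertical_case S I alpha e ->
  magnetic S nabla I alpha q.
Proof.
move=> r3 ve; split=> [|t It]; first exact: frenet_unit_speed frE.
rewrite (order1_hnabla (vertical_order1 r3 ve) It).
rewrite (vertical_velocity ve.1 It (ve.2 t It)).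
by rewrite linearZ /= phi_xi !scaler0.
Qed.

Lemma order1_contact_angle : r = 1%N -> exists theta, contact_angle S I alpha theta.
Proof.
move=> r1; have [t0 It0] := I0; pose h := eta_velocity S alpha t0.
exists (acos h); split; first by rewrite acos_ge0 ?acos_lepi ?eta_velocity_bound.
move=> t It; rewrite acosK ?in_itv ?eta_velocity_bound //.
by rewrite /h !eta_velocityE //; exact: eta1_const_order1.
Qed.

Lemma order1_magnetic theta : r = 1%N -> contact_angle S I alpha theta ->
  magnetic S nabla I alpha (2 * cos theta).
Proof.
move=> r1 [_ th]; split=> [|t It]; first exact: frenet_unit_speed frE.
by rewrite order1_hnabla // th // addNr scale0r.
Qed.

Lemma order2_phi t : r = 2%N -> phi_curve S nabla r I E k -> I t ->
  H 1%N t = 0 -> H 2%N t = 0 ->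
  let b := g S (alpha t) (phi S (alpha t) (E 1%N t)) (E 2%N t) in
  phi S (alpha t) (E 1%N t) = b *: E 2%N t /\ b ^+ 2 = 1.
Proof.
move=> r2 [_ inv] It H1 H2; have := inv t It; rewrite r2 /=.
apply: horizontal_frame2_phi => //; try by rewrite frenet_unit ?r2.
by rewrite frenet_orth ?r2.
Qed.

(** When [phi E_1] is a multiple of E_2, the first Frenet equation is the
    magnetic equation for the strength that matches the coefficients. *)
Lemma magnetic_of_phi_E2 (q b : R) : (1 < r)%N ->
  (forall t, I t -> phi S (alpha t) (E 1%N t) = b *: E 2%N t /\
     (- q + 2 * eta_velocity S alpha t) * b = k 1%N t) ->
  magnetic S nabla I alpha q.
Proof.
move=> r1 Hb; split=> [|t It]; first exact: frenet_unit_speed frE.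
have [phE kE] := Hb t It.
rewrite hnabla_velocity // (frenet_eq frE) ?(ltnW r1) //= r1 add0r.
by rewrite -kE -scalerA -phE (frenet_velocity frE It).
Qed.

End FrenetCurves.

(** * The cases of the classification *)

Section HelixCases.
Context {R : realType} {m : nat} {N : manifold R m}.
Variables (S : acm N) (nabla : christoffel N) (I : set R) (alpha : R -> N).
Variables (r : nat) (E : nat -> cfield alpha) (k : nat -> R -> R).
Hypotheses (sasS : sasakian S) (lcN : levi_civita (g S) nabla).
Hypotheses (oI : open I) (iI : is_interval I) (I0 : I !=set0).
Hypotheses (frE : frenet S nabla r I E k) (phE : phi_curve S nabla r I E k).
Hypothesis r3 : (r <= 3)%N.

Local Notation hnabla := (covD_along (tanaka_webster S nabla)).
Local Notation H i := (fun t => eta S (alpha t) (E i t)).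
Local Notation b := (fun t => g S (alpha t) (phi S (alpha t) (E 1%N t)) (E 2%N t)).

Lemma legendre_case_order2 : legendre_case S I alpha k -> r = 2%N.
Proof.
move=> L; have [t It] := I0; have r0 := frenet_order frE.
have r1 : r != 1%N.
  apply/eqP => r1; apply: (L t It).2.
  by apply: (frenet_zero frE) => //; rewrite r1.
have rn3 : r != 3%N.
  apply/eqP => re; apply: (horizontal_helix3 sasS lcN oI I0 frE re phE) => s Is.
  by rewrite -(eta_velocityE frE Is) (L s Is).1.
by move: r r0 r1 rn3 r3 => [|[|[|[|?]]]].
Qed.

(** Here E_1, E_2 and xi are orthonormal, so [phi E_1] is E_2 up to a sign, which
    is constant along the curve. *)
Lemma legendre_case_magnetic k1 : legendre_case S I alpha k ->
  (forall t, I t -> k 1%N t = k1) ->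
  exists2 delta, (forall t, I t -> delta = Num.sg (b t)) &
    magnetic S nabla I alpha (- delta * k1).
Proof.
move=> L kk1; have r2 := legendre_case_order2 L; have [t0 It0] := I0.
have r1 : (1 < r)%N by rewrite r2.
have H1 t : I t -> H 1%N t = 0.
  by move=> It; rewrite -(eta_velocityE frE It) (L t It).1.
have H2 t : I t -> H 2%N t = 0.
  move=> It; have := eta_frenet_const sasS lcN oI frE (i := 1%N) _ H1 It.
  rewrite r2 /= add0r => /(_ isT)/eqP; rewrite mulf_eq0 => /orP[/eqP k10|/eqP//].
  by have [_ []] := L t It.
have P t : I t -> phi S (alpha t) (E 1%N t) = b t *: E 2%N t /\ b t ^+ 2 = 1.
  by move=> It; exact (order2_phi frE r2 phE It (H1 t It) (H2 t It)).
have bc t : I t -> b t = b t0.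
  move=> It; apply: (constant_of_three_values (f := b) iI oI (oner_neq0 R)) => //.
    by move=> s Is; exact (diff_delta oI frE r1 Is).
  by move=> s Is; rewrite (P s Is).2 expr1n subrr mulr0.
have b2 := (P t0 It0).2.
have sgb : Num.sg (b t0) = b t0.
  by move/eqP: b2; rewrite sqrf_eq1 => /orP[]/eqP->; rewrite ?sgr1 ?sgrN1.
exists (b t0) => [t It|]; first by rewrite bc // sgb.
apply: (magnetic_of_phi_E2 oI frE (b := b t0) r1) => t It; split.
  by rewrite (P t It).1 bc.
by rewrite (L t It).1 kk1 // -[RHS]mul1r -b2; ring.
Qed.

Lemma slant_helix_case_order3 : slant_helix_case S I alpha k -> r = 3%N.
Proof.
move=> L; have [t It] := I0; apply/eqP; rewrite eqn_leq r3 ltnNge /=.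
apply/negP => r2; apply: (L t It).2; exact: frenet_zero frE _ _ r2 It.
Qed.

(** The values eta(E_1) = eps k_2 / K and eta(E_3) = eps k_1 / K, with
    K^2 = k_1^2 + k_2^2, have squares adding up to 1; so xi lies in the plane
    of E_1 and E_3 and [phi E_1] is E_2 times delta k_1 / K. *)
Lemma slant_helix_case_magnetic k1 k2 : slant_helix_case S I alpha k ->
  (forall t, I t -> k 1%N t = k1) -> (forall t, I t -> k 2%N t = k2) ->
  exists delta eps,
    (forall t, I t -> delta = Num.sg (b t) /\ eps = Num.sg (eta_velocity S alpha t)) /\
    magnetic S nabla I alpha (- delta * Num.sqrt (k1 ^+ 2 + k2 ^+ 2)
             + 2 * eps * k2 / Num.sqrt (k1 ^+ 2 + k2 ^+ 2)).
Proof.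
move=> L kk1 kk2; have re := slant_helix_case_order3 L; have [t0 It0] := I0.
have r1 : (1 < r)%N by rewrite re.
have k10 : 0 < k1 by rewrite -(kk1 t0 It0); apply: frenet_pos frE _ _ _ It0.
have k20 : 0 < k2 by rewrite -(kk2 t0 It0); apply: frenet_pos frE _ _ _ It0; rewrite re.
set K := Num.sqrt _.
have K2 : K ^+ 2 = k1 ^+ 2 + k2 ^+ 2 by rewrite sqr_sqrtr // addr_ge0 ?sqr_ge0.
have K0 : 0 < K by rewrite sqrtr_gt0 addr_gt0 // exprn_gt0.
have Kn0 : K != 0 by rewrite gt_eqF.
(* The sign may a priori vary with t and even be 0; the values of eta(E_1) are
   only known to lie in {- k2 / K, 0, k2 / K}. *)
have H1E t : I t -> H 1%N t = Num.sg (H 1%N t) * (k2 / K).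
  move=> It; have [e _] := L t It.
  by rewrite (eta_velocityE frE It) (kk1 t It) (kk2 t It) -/K -mulrA in e.
have s10 : k1 / K != 0 by rewrite mulf_neq0 ?invr_eq0 // gt_eqF.
have s20 : k2 / K != 0 by rewrite mulf_neq0 ?invr_eq0 // gt_eqF.
have H1c t : I t -> H 1%N t = H 1%N t0.
  move=> It; apply: (constant_of_three_values (f := H 1%N) iI oI s20) => // s Is.
    by apply: (derive_eta_frenet sasS lcN oI frE _ Is).1; rewrite re.
  rewrite {2}H1E // exprMn.
  by case: sgrP => [->|_|_]; rewrite ?mul0r // ?sqrrN ?expr1n mul1r subrr mulr0.
set C := H 1%N t0 in H1c.
have H2 t : I t -> H 2%N t = 0.
  move=> It; have := eta_frenet_const sasS lcN oI frE (i := 1%N) _ H1c It.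
  rewrite re /= add0r kk1 // => /(_ isT)/eqP.
  by rewrite mulf_eq0 gt_eqF //= => /eqP.
have H3 t : I t -> H 3%N t = k1 * C / k2.
  move=> It; have := eta_frenet_const sasS lcN oI frE (i := 2%N) _ H2 It.
  rewrite re /= kk1 // kk2 // H1c // => /(_ isT)/eqP.
  rewrite addrC mulNr subr_eq0 => /eqP <-; rewrite mulrAC mulfV ?mul1r //.
  by rewrite gt_eqF.
have C0 : C != 0.
  apply/eqP => C0; apply: (horizontal_helix3 sasS lcN oI I0 frE re phE) => s Is.
  by rewrite H1c.
set eps := Num.sg C; have CE : C = eps * (k2 / K) := H1E t0 It0.
have eps2 : eps ^+ 2 = 1 by rewrite sqr_sg C0.
have C2 : C ^+ 2 = k2 ^+ 2 / K ^+ 2 by rewrite CE exprMn eps2 mul1r expr_div_n.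
have b2C : 1 - C ^+ 2 = (k1 / K) ^+ 2.
  rewrite C2 expr_div_n -[1](mulfV (expf_neq0 2 Kn0)) -mulrBl.
  by rewrite {1}K2 addrK.
have P t : I t -> phi S (alpha t) (E 1%N t) = b t *: E 2%N t /\ b t ^+ 2 = (k1 / K) ^+ 2.
  move=> It; rewrite -b2C.
  have inv := phE.2 t It; rewrite re /= in inv.
  apply: (reeb_in_frame_phi (frame3_orthonormal frE re It) inv (H1c t It) (H2 t It)
    (H3 t It)).
    by rewrite !mulf_neq0 ?invr_eq0 // gt_eqF.
  rewrite [X in _ + X](_ : _ = (k1 / k2) ^+ 2 * C ^+ 2); last by rewrite mulrAC exprMn.
  rewrite C2 expr_div_n mulrA divfK ?expf_neq0 ?gt_eqF //.
  by rewrite -mulrDl addrC -K2 mulfV // expf_neq0.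
have bc t : I t -> b t = b t0.
  move=> It; apply: (constant_of_three_values (f := b) iI oI s10) => //.
    by move=> s Is; exact (diff_delta oI frE r1 Is).
  by move=> s Is; rewrite (P s Is).2 subrr mulr0.
set delta := Num.sg (b t0).
have bE : b t0 = delta * (k1 / K).
  rewrite {1}[b t0]numEsg; congr (_ * _).
  have /eqP := (P t0 It0).2; rewrite -(real_normK (num_real (b t0))) eqrXn2 ?normr_ge0 //.
    by move/eqP.
  by rewrite ltW // divr_gt0.
have b0 : b t0 != 0 by rewrite -sqrf_eq0 (P t0 It0).2 sqrf_eq0.
have delta2 : delta * delta = 1 by rewrite -expr2 sqr_sg b0.
exists delta, eps; split=> [t It|].
  by rewrite (eta_velocityE frE It) H1c // bc.
apply: (magnetic_of_phi_E2 oI frE (b := b t0) r1) => t It; split.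
  by rewrite (P t It).1 bc.
rewrite (eta_velocityE frE It) H1c // kk1 // CE.
have -> : - (- delta * K + 2 * eps * k2 / K) + 2 * (eps * (k2 / K)) = delta * K by ring.
by rewrite bE mulrACA delta2 mul1r mulrC divfK.
Qed.

(** Along a magnetic curve the acceleration is in the image of [phi]. *)
Lemma magnetic_eta_const q : magnetic S nabla I alpha q ->
  forall s t, I s -> I t -> H 1%N s = H 1%N t.
Proof.
move=> [us mq]; apply: constant_of_derive0 => // t It.
have r1 : (0 < 1 <= r)%N by rewrite (frenet_order frE).
have [d D] := derive_eta_along oI us.1 sasS lcN It (frenet_smooth frE r1).
split; first exact: d.
apply: etrans D _.
by rewrite -(hnabla_velocity oI frE It) mq // etaZ eta_phi mulr0.
Qed.

(** A geodesic magnetic curve satisfies (- q + 2 cos theta) phi E_1 = 0; at an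
    angle with zero cosine this says q = 0, because [phi E_1] is then a unit
    vector. *)
Lemma magnetic_order1 q : r = 1%N -> magnetic S nabla I alpha q -> q <> 0 ->
  (forall e, ~ vertical_case S I alpha e) -> slant_geodesic_case S I alpha k.
Proof.
move=> r1 mq q0 nv t It; split; last first.
  by apply: (frenet_zero frE) => //; rewrite r1.
have c s : I s -> eta_velocity S alpha s = eta_velocity S alpha t.
  move=> Is; rewrite !(eta_velocityE frE) //; exact: magnetic_eta_const mq _ _ Is It.
rewrite !inE; apply/negP => /or3P[/eqP e|/eqP e|/eqP e].
- by apply: (nv (- 1)); split; [right|move=> s Is; rewrite c].
- have := mq.2 t It; rewrite (order1_hnabla oI frE r1 It) e mulr0 addr0.
  move/esym/eqP; rewrite scaler_eq0 oppr_eq0 => /orP[/eqP//|/eqP p0].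
  have := eta_velocity_sq frE It; rewrite p0 e g0l expr0n subr0 => /esym/eqP.
  by rewrite oner_eq0.
- by apply: (nv 1); split; [left|move=> s Is; rewrite c].
Qed.

(** The first Frenet equation and the magnetic equation express the same vector. *)
Lemma magnetic_E2 q t : (1 < r)%N -> magnetic S nabla I alpha q -> I t ->
  exists2 mu, E 2%N t = mu *: phi S (alpha t) (E 1%N t) & H 2%N t = 0.
Proof.
move=> r1 mq It; have k10 : k 1%N t != 0.
  by rewrite gt_eqF //; apply: (frenet_pos frE) => //.
have := mq.2 t It; rewrite (hnabla_velocity oI frE It).
rewrite (frenet_eq frE) ?(ltnW r1) //= r1 add0r -(frenet_velocity frE It).
set l := (X in X *: phi _ _ _) => e.
have E2 : E 2%N t = ((k 1%N t)^-1 * l) *: phi S (alpha t) (E 1%N t).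
  by rewrite -scalerA -e scalerA mulVf // scale1r.
exists ((k 1%N t)^-1 * l) => //.
by rewrite E2 etaZ eta_phi mulr0.
Qed.

(** As E_2 is horizontal, its scalar Frenet equation reads k_1 eta(E_1) = 0. *)
Lemma magnetic_order2 q : r = 2%N -> magnetic S nabla I alpha q ->
  legendre_case S I alpha k.
Proof.
move=> r2 mq t It; have r1 : (1 < r)%N by rewrite r2.
have k1 : 0 < k 1%N t by apply: (frenet_pos frE).
split; last by apply/eqP; rewrite gt_eqF.
have H2 s : I s -> H 2%N s = 0 by move=> Is; have [] := magnetic_E2 r1 mq Is.
have := eta_frenet_const sasS lcN oI frE (i := 2%N) _ H2 It.
rewrite r2 /= addr0 => /(_ isT)/eqP.
by rewrite mulf_eq0 oppr_eq0 gt_eqF //= -(eta_velocityE frE It) => /eqP.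
Qed.

(** As E_2 is a multiple of [phi E_1], the vector [phi E_2] is a combination of
    E_1 and xi. It lies in the span of the frame, so its length is computed
    from its components there, which yields eta(E_1)^2 + eta(E_3)^2 = 1. With
    k_2 eta(E_3) = k_1 eta(E_1), the value of eta(E_1) follows. *)
Lemma magnetic_order3 q : r = 3%N -> magnetic S nabla I alpha q ->
  ~ legendre_case S I alpha k -> slant_helix_case S I alpha k.
Proof.
move=> re mq nL t It; have r1 : (1 < r)%N by rewrite re.
have k1 s : I s -> 0 < k 1%N s by move=> Is; apply: (frenet_pos frE).
have k2 : 0 < k 2%N t by apply: (frenet_pos frE) => //; rewrite re.
split; last by apply/eqP; rewrite gt_eqF.
have H2 s : I s -> H 2%N s = 0 by move=> Is; have [] := magnetic_E2 r1 mq Is.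
set c := eta_velocity S alpha t.
have c0 : c != 0.
  apply/eqP => c0; apply: nL => s Is; split; last by apply/eqP; rewrite gt_eqF ?k1.
  rewrite (eta_velocityE frE Is) -c0 /c (eta_velocityE frE It).
  exact: magnetic_eta_const mq _ _ Is It.
have cE : H 1%N t = c by rewrite /c (eta_velocityE frE It).
have H3 : k 2%N t * H 3%N t = k 1%N t * c.
  have := eta_frenet_const sasS lcN oI frE (i := 2%N) _ H2 It.
  rewrite re /= cE => /(_ isT)/eqP.
  by rewrite addrC mulNr subr_eq0 => /eqP.
have [mu E2 _] := magnetic_E2 r1 mq It.
have on := frame3_orthonormal frE re It; have [[g11 g22 g33] [g12 g13 g23]] := on.
have inv := phE.2 t It; rewrite re /= in inv.
have [_ i2 _] := phi_invariant3 inv.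
have mu1 : 1 = mu ^+ 2 * (1 - c ^+ 2).
  by rewrite -[LHS]g22 E2 gZl gZr g_phi_phi g11 cE; ring.
have phiE2 : phi S (alpha t) (E 2%N t) =
    mu *: (- E 1%N t + c *: xi S (alpha t)).
  by rewrite E2 linearZ /= phi_phi cE.
have := parseval3 (phi S (alpha t) (E 2%N t)) on i2.
rewrite g_phi_phi g22 H2 // g_phi_self mulr0 subr0 phiE2.
rewrite !gZl !gDl !gNl !gZl g11 g13 !(gC S (xi S (alpha t))) !g_xi cE.
move: H3; set z := eta S (alpha t) (E 3%N t) => H3 P.
have cz : c ^+ 2 + z ^+ 2 = 1.
  have mu0 : mu ^+ 2 != 0.
    by apply/eqP => mu0; move: mu1; rewrite mu0 mul0r => /eqP; rewrite oner_eq0.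
  have c20 : c ^+ 2 != 0 by rewrite sqrf_eq0.
  apply: (mulfI c20); apply: (mulfI mu0); apply/eqP; rewrite -subr_eq0; apply/eqP.
  have Q : mu ^+ 2 * (1 - c ^+ 2) = mu ^+ 2 * ((1 - c ^+ 2) ^+ 2 + c ^+ 2 * z ^+ 2).
    apply: etrans (esym mu1) (etrans P _); ring.
  have -> : mu ^+ 2 * (c ^+ 2 * (c ^+ 2 + z ^+ 2)) - mu ^+ 2 * (c ^+ 2 * 1) =
    mu ^+ 2 * ((1 - c ^+ 2) ^+ 2 + c ^+ 2 * z ^+ 2) - mu ^+ 2 * (1 - c ^+ 2) by ring.
  by rewrite Q subrr.
set K := Num.sqrt _.
have K2 : K ^+ 2 = k 1%N t ^+ 2 + k 2%N t ^+ 2 by rewrite sqr_sqrtr // addr_ge0 ?sqr_ge0.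
have K0 : 0 < K by rewrite sqrtr_gt0 addr_gt0 // exprn_gt0 // k1.
have cK : (`|c| * K) ^+ 2 = k 2%N t ^+ 2.
  have kz : k 2%N t ^+ 2 * z ^+ 2 = k 1%N t ^+ 2 * c ^+ 2 by rewrite -!exprMn H3.
  rewrite exprMn real_normK ?num_real // K2 -[RHS]mulr1 -cz [RHS]mulrDr kz.
  by ring.
have {}cK : `|c| * K = k 2%N t.
  by apply/eqP; rewrite -(eqrXn2 (isT : (0 < 2)%N)) ?mulr_ge0 // ?ltW //; apply/eqP.
by rewrite -cK mulrA mulfK ?gt_eqF // -numEsg.
Qed.

End HelixCases.

Theorem theorem2 (R : realType) (n : nat) (N : manifold R (2 * n).+1)
  (S : acm N) (nabla : christoffel N) (I : set R) (alpha : R -> N)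
  (r : nat) (E : nat -> cfield alpha) (k : nat -> R -> R) :
  sasakian S -> levi_civita (g S) nabla ->
  open I -> is_interval I -> I !=set0 ->
  phi_helix S nabla r I E k ->
  (* a *)
  (forall e, vertical_case S I alpha e ->
     [/\ forall t, I t -> velocity alpha t = e *: xi S (alpha t),
         geodesic S nabla I E k
       & forall q, magnetic S nabla I alpha q]) /\
  (* b *)
  (slant_geodesic_case S I alpha k ->
     [/\ geodesic S nabla I E k, slant S I alpha, ~ legendre S I alpha
       & exists2 theta, contact_angle S I alpha theta
                      & magnetic S nabla I alpha (2 * cos theta)]) /\
  (* c *)
  (legendre_case S I alpha k ->
     [/\ legendre S I alpha, phi_curve S nabla 2 I E k,
         circle S nabla I E k
       & exists delta k1 : R,
           (forall t, I t ->
              delta = Num.sg (g S (alpha t) (phi S (alpha t) (E 1%N t))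
                                            (E 2%N t))
              /\ k 1%N t = k1)
           /\ magnetic S nabla I alpha (- delta * k1)]) /\
  (* d *)
  (slant_helix_case S I alpha k ->
     exists delta eps k1 k2 : R,
       (forall t, I t ->
          [/\ delta = Num.sg (g S (alpha t) (phi S (alpha t) (E 1%N t))
                                            (E 2%N t)),
              eps = Num.sg (eta_velocity S alpha t),
              k 1%N t = k1 & k 2%N t = k2])
       /\ magnetic S nabla I alpha
            (- delta * Num.sqrt (k1 ^+ 2 + k2 ^+ 2)
             + 2 * eps * k2 / Num.sqrt (k1 ^+ 2 + k2 ^+ 2))) /\
  (* e *)
  ((forall e, ~ vertical_case S I alpha e) ->
   ~ slant_geodesic_case S I alpha k ->
   ~ legendre_case S I alpha k ->
   ~ slant_helix_case S I alpha k ->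
   forall q, q <> 0 -> ~ magnetic S nabla I alpha q).
Proof.
move=> sasS lcN oI iI I0 [phE cases].
have frE := phE.1.
have [t0 It0] := I0.
have r3 : (r <= 3)%N by case: cases => [[->]|[->]|[->]].
have circle2 : r = 2%N -> circle S nabla I E k.
  by move=> r2; case: cases => [[r1]|[]|[r1]] //; rewrite r2 in r1.
have helix : r = 3%N -> helix3 S nabla I E k.
  by move=> re; case: cases => [[r1]|[r1]|[]] //; rewrite re in r1.
have const_at f : constant_on I f -> forall t, I t -> f t = f t0.
  by move=> [a fa] t It; rewrite !fa.
have order1_geodesic : r = 1%N -> geodesic S nabla I E k.
  by move=> r1; rewrite r1 in frE.
split; [|split; [|split; [|split]]].
- move=> e ve; split=> [t It||q].
  + exact (vertical_velocity frE ve.1 It (ve.2 t It)).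
  + exact: order1_geodesic (vertical_order1 sasS lcN oI I0 frE r3 ve).
  + exact: (vertical_magnetic sasS lcN oI I0 frE q r3 ve).
- move=> sg.
  have r1 : r = 1%N.
    by apply: (frenet_order1 I0 frE) => t It; exact: (sg t It).2.
  have [theta th] := order1_contact_angle sasS lcN oI iI I0 frE r1.
  split; first exact: order1_geodesic.
  + by split; [exact: frenet_unit_speed frE|exists theta].
  + move=> [_ leg]; have := (sg t0 It0).1.
    by rewrite leg // !inE eqxx orbT.
  + exists theta => //; exact (order1_magnetic oI frE r1 th).
- move=> leg; have r2 := legendre_case_order2 sasS lcN oI I0 frE phE r3 leg.
  have circ := circle2 r2; split=> //.
  + by split; [exact: frenet_unit_speed frE|move=> t It; exact: (leg t It).1].
  + by rewrite r2 in phE.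
  + have kk1 := const_at _ circ.2.
    have [delta dE mag] := legendre_case_magnetic sasS lcN oI iI I0 frE phE r3 leg kk1.
    exists delta, (k 1%N t0); split=> // t It; split; [exact: dE|exact: kk1].
- move=> sh; have re := slant_helix_case_order3 I0 frE r3 sh.
  have [_ /const_at kk1 /const_at kk2] := helix re.
  have [delta [eps [de mag]]] :=
    slant_helix_case_magnetic sasS lcN oI iI I0 frE phE r3 sh kk1 kk2.
  exists delta, eps, (k 1%N t0), (k 2%N t0); split=> // t It.
  by have [dE eE] := de t It; split; [| |exact: kk1|exact: kk2].
- move=> nv ns nl nh q q0 mag.
  have r0 := frenet_order frE.
  have : [\/ r = 1%N, r = 2%N | r = 3%N].
    move: r r0 r3 {phE cases frE circle2 helix order1_geodesic} => [|[|[|[|?]]]] // _ _.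
    + exact: Or31.
    + exact: Or32.
    + exact: Or33.
  case=> re.
  + exact/ns/(magnetic_order1 sasS lcN oI iI frE re mag q0 nv).
  + exact/nl/(magnetic_order2 sasS lcN oI frE re mag).
  + exact/nh/(magnetic_order3 sasS lcN oI iI frE phE re mag nl).
Qed.
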